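(* The singular point $(0,0)$ of the curve $S$ given by $(2x+y)(2x-y)(y+x^2)(y-x^2)=0$ has the following induced relations: $$x_4x_3x_2x_1=x_1x_4x_3x_2=x_3x_2x_1x_4,\qquad x_4x_3x_2x_1x_3x_2=x_2x_4x_3x_2x_1x_3,$$ where $\{x_1,x_2,x_3,x_4\}$ are the generators of the standard g-base.
   Context: Let $E=\{x\in\mathbb{C}:|x|\le 1\}$, $D=\{y\in\mathbb{C}:|y|\le 4\}$, and regard $S$ as a curve in $E\times D$. The projection of $S$ to $E$ has fibers of constant cardinality $n$ ($n=4$ here) except over $x=0$. Let $K\subset D$ be the set of $y$-coordinates of the points of $S$ over $x=1$. A motion of $K$ in $D$ consists of $n$ continuous functions $m_i:[0,1]\to D$ with $m_i(t)\ne m_j(t)$ for all $t$ and $i\neq j$, and $\{m_i(0)\}=\{m_i(1)\}=K$. It is realized by a continuous family of diffeomorphisms $D_t$ of $D$, $D_0=\mathrm{Id}$, equal to the identity on $\partial D$, with $D_t(m_i(0))=m_i(t)$; the braid induced by the motion is the class of $D_1$ in the braid group $B_n[D,K]$, the group of diffeomorphisms of $D$ preserving $K$ and equal to the identity on $\partial D$, two being identified if they induce the same automorphism of $\pi_1(D-K,u_0)$. The local braid monodromy $\beta$ of $S$ at $(0,0)$ is the braid induced by the motion formed by the points of $S$ over $x=e^{2\pi i t}$, $0\le t\le 1$. Standard g-base: take the base point $u_0=-4i$ and let $p_1<\dots<p_n$ be the (real) points of $K$. The loop $x_i$ goes from $u_0$ along the straight segment to near $p_i$, once counterclockwise around $p_i$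 on a small circle, and back. In a product of loops the left factor is traversed first. The group $\pi_1(D-K,u_0)$ is free on $x_1,\dots,x_n$. The relations induced by $\beta$ are $\beta(x_j)=x_j$, $j=1,\dots,n$. Saying that the singular point ''has the induced relations $R$'' means that $R$ and $\{\beta(x_j)=x_j\}_j$ have the same normal closure in the free group on $x_1,\dots,x_n$. *)

(* Defs.v *)
From Stdlib Require Import Reals List.
From Coquelicot Require Import Coquelicot.
Import ListNotations.
Open Scope R_scope.

Definition unit_I (t : R) : Prop := 0 <= t <= 1.

Definition disk_E (x : C) : Prop := Cmod x <= 1.
Definition disk_D (y : C) : Prop := Cmod y <= 4.
Definition boundary_D (y : C) : Prop := Cmod y = 4.

(** The base point -4i; it lies on the boundary of D. *)
Definition u0 : C := (0, -4).

Definition cis (a : R) : C := (cos a, sin a).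

(** A path is a total function R -> C of which only the restriction to [0,1]
    matters.  The elements of pi_1(D - K, u0) are represented by loops, and
    equality in pi_1 is [homotopic K]. *)

Definition path := R -> C.

Definition is_loop (K : C -> Prop) (g : path) : Prop :=
  continuous_on unit_I g /\
  (forall t, unit_I t -> disk_D (g t) /\ ~ K (g t)) /\
  g 0 = u0 /\ g 1 = u0.

Definition homotopic (K : C -> Prop) (g h : path) : Prop :=
  exists H : R -> R -> C,
    continuous_on (fun q : R * R => unit_I (fst q) /\ unit_I (snd q))
                  (fun q : R * R => H (fst q) (snd q)) /\
    (forall s t, unit_I s -> unit_I t -> disk_D (H s t) /\ ~ K (H s t)) /\
    (forall s, unit_I s -> H s 0 = u0 /\ H s 1 = u0) /\
    (forall t, unit_I t -> H 0 t = g t /\ H 1 t = h t).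

Definition const_loop : path := fun _ => u0.

(** [g] is traversed first. *)
Definition concat (g h : path) : path :=
  fun t => if Rle_dec t (1/2) then g (2 * t) else h (2 * t - 1).

Definition inverse (g : path) : path := fun t => g (1 - t).

(** The product of [x i] for [i] in [l], the leftmost factor first. *)
Definition word (x : nat -> path) (l : list nat) : path :=
  fold_right (fun i g => concat (x i) g) const_loop l.

(** A set of relations: [Rel g h] is the relation g = h. *)
Definition relations := path -> path -> Prop.

Definition relations_of_list (l : list (path * path)) : relations :=
  fun g h => In (g, h) l.

(** The loops whose class belongs to the normal closure in pi_1(D - K, u0) of
    the elements g h^-1, for the relations g = h of [Rel]. *)
Inductive normal_closure (K : C -> Prop) (Rel : relations) : path -> Prop :=
| nc_gen g h : Rel g h -> normal_closure K Rel (concat g (inverse h))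
| nc_one : normal_closure K Rel const_loop
| nc_mul g h : normal_closure K Rel g -> normal_closure K Rel h ->
    normal_closure K Rel (concat g h)
| nc_inv g : normal_closure K Rel g -> normal_closure K Rel (inverse g)
| nc_conj a g : is_loop K a -> normal_closure K Rel g ->
    normal_closure K Rel (concat a (concat g (inverse a)))
| nc_homotopic g h : normal_closure K Rel g -> homotopic K g h ->
    normal_closure K Rel h.

Definition same_normal_closure (K : C -> Prop) (Rel1 Rel2 : relations) : Prop :=
  forall g : path, normal_closure K Rel1 g <-> normal_closure K Rel2 g.

Fixpoint Ck (k : nat) (U : C -> Prop) (f : C -> R) : Prop :=
  (forall z : C, U z -> continuous f z) /\
  match k with
  | O => True
  | S k' => exists f1 f2 : C -> R,
      (forall a b : R, U (a, b) ->
         is_derive (fun s : R => f (s, b)) a (f1 (a, b)) /\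
         is_derive (fun s : R => f (a, s)) b (f2 (a, b))) /\
      Ck k' U f1 /\ Ck k' U f2
  end.

Definition smooth (U : C -> Prop) (f : C -> C) : Prop :=
  forall k : nat, Ck k U (fun z => fst (f z)) /\ Ck k U (fun z => snd (f z)).

(** Smooth up to the boundary: smoothly extendable to a neighbourhood of D. *)
Definition smooth_on_D (f : C -> C) : Prop :=
  exists (U : C -> Prop) (g : C -> C),
    open U /\ (forall y, disk_D y -> U y) /\
    (forall y, disk_D y -> g y = f y) /\ smooth U g.

Definition diffeo_D (f : C -> C) : Prop :=
  smooth_on_D f /\ (forall y, disk_D y -> disk_D (f y)) /\
  exists g : C -> C,
    smooth_on_D g /\ (forall y, disk_D y -> disk_D (g y)) /\
    (forall y, disk_D y -> g (f y) = y) /\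
    (forall y, disk_D y -> f (g y) = y).

(** [f] represents an element of B_n[D,K] (for [K] a subset of D). *)
Definition braid_representative (K : C -> Prop) (f : C -> C) : Prop :=
  diffeo_D f /\
  (forall y, boundary_D y -> f y = y) /\
  (forall y, disk_D y -> (K (f y) <-> K y)).

(** The action of [f] on (loops representing elements of) pi_1(D - K, u0). *)
Definition act (f : C -> C) (g : path) : path := fun t => f (g t).

(** Equality in B_n[D,K]: the same automorphism of pi_1(D - K, u0). *)
Definition same_braid (K : C -> Prop) (f1 f2 : C -> C) : Prop :=
  forall g : path, is_loop K g -> homotopic K (act f1 g) (act f2 g).

(** The [n] strands, as well as the [n] points of [K] and the [n] generators,
    are numbered from 1 to [n]. *)

Definition idx (n i : nat) : Prop := (1 <= i <= n)%nat.

Definition is_motion (n : nat) (K : C -> Prop) (m : nat -> R -> C) : Prop :=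
  (forall i, idx n i -> continuous_on unit_I (m i)) /\
  (forall i t, idx n i -> unit_I t -> disk_D (m i t)) /\
  (forall i j t, idx n i -> idx n j -> i <> j -> unit_I t -> m i t <> m j t) /\
  (forall y, K y <-> exists i, idx n i /\ m i 0 = y) /\
  (forall y, K y <-> exists i, idx n i /\ m i 1 = y).

Definition realizes (n : nat) (m : nat -> R -> C) (Dt : R -> C -> C) : Prop :=
  (forall t, unit_I t -> diffeo_D (Dt t)) /\
  continuous_on (fun q : R * C => unit_I (fst q) /\ disk_D (snd q))
                (fun q : R * C => Dt (fst q) (snd q)) /\
  (forall y, disk_D y -> Dt 0 y = y) /\
  (forall t y, unit_I t -> boundary_D y -> Dt t y = y) /\
  (forall i t, idx n i -> unit_I t -> Dt t (m i 0) = m i t).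

Definition induced_braid (n : nat) (K : C -> Prop) (m : nat -> R -> C)
    (beta : C -> C) : Prop :=
  braid_representative K beta /\
  exists Dt : R -> C -> C, realizes n m Dt /\ same_braid K beta (Dt 1).

Definition curve := C -> C -> Prop.

Definition fiber_one (S : curve) : C -> Prop := fun y => S (RtoC 1) y.

Definition motion_of_curve (n : nat) (S : curve) (m : nat -> R -> C) : Prop :=
  is_motion n (fiber_one S) m /\
  (forall t y, unit_I t ->
     (S (cis (2 * PI * t)) y <-> exists i, idx n i /\ m i t = y)).

(** [beta] represents the local braid monodromy of [S] at (0,0). *)
Definition local_braid_monodromy (n : nat) (S : curve) (beta : C -> C) : Prop :=
  exists m : nat -> R -> C,
    motion_of_curve n S m /\ induced_braid n (fiber_one S) m beta.

Definition induced_relations (n : nat) (beta : C -> C) (x : nat -> path)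
    : relations :=
  fun g h => exists j, idx n j /\ g = act beta (x j) /\ h = x j.

(** The curve (2x+y)(2x-y)(y+x^2)(y-x^2) = 0 in E x D. *)
Definition curve_S : curve := fun x y =>
  disk_E x /\ disk_D y /\
  ((RtoC 2 * x + y) * (RtoC 2 * x - y) * (y + x * x) * (y - x * x) = RtoC 0)%C.

Definition ordered_points (n : nat) (K : C -> Prop) (p : nat -> R) : Prop :=
  (forall i j, idx n i -> idx n j -> (i < j)%nat -> p i < p j) /\
  (forall y, K y <-> exists i, idx n i /\ y = RtoC (p i)).

Definition segment (a b : C) : path := fun t => (a + RtoC t * (b - a))%C.

Definition direction (p : R) : C :=
  ((u0 - RtoC p) / RtoC (Cmod (u0 - RtoC p)))%C.

(** The circle of radius [eps] around [p], once counterclockwise, starting on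
    the segment from [p] to [u0]. *)
Definition small_circle (eps p : R) : path :=
  fun t => (RtoC p + RtoC eps * direction p * cis (2 * PI * t))%C.

Definition g_loop (eps p : R) : path :=
  let tail := segment u0 (RtoC p + RtoC eps * direction p)%C in
  concat tail (concat (small_circle eps p) (inverse tail)).

Definition standard_g_base (eps : R) (p : nat -> R) (i : nat) : path :=
  g_loop eps (p i).

(* Main.v *)
(** The points of S over x = cis (2 pi t) are -2x, -x^2, x^2, 2x, so the monodromy is realized by the
    rotations y |-> y cis (2 pi t psi(|y|)) with psi(1) = 2, psi(2) = 1, psi(4) = 0.  If D_t is any
    realization and T_t is this one, then T_1 T_s^-1 D_s, 0 <= s <= 1, is a homotopy from T_1 to D_1
    through maps preserving K, so every representative acts on loops like T_1; here psi may be any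
    continuous function with these values.  Taking it to be a sum of two functions writes T_1 as a
    full twist around all four points after a full twist around the inner two.  A full twist of a
    disk is homotopic to the identity through rotations that fix the punctures and move the base
    point once around the boundary, so it conjugates by the boundary loop.  With d = x4 x3 x2 x1 and
    e = x3 x2 this gives beta(x_j) = d x_j d^-1 for j = 1, 4 and d e x_j (d e)^-1 for j = 2, 3, and
    the relations say that d commutes with x1 and x4, and d e with x2 and x3.

    All words come from the arcs c_k crossing the real axis in the k-th gap between the points of K:
    the complement of K cut along the other gaps is star-shaped, which determines c_k up to homotopy,
    and a counterclockwise loop that crosses upwards in gap i and downwards in gap j is c_i c_j^-1;
    in particular x_k = c_k c_(k-1)^-1 and d = c_4 c_0^-1. *)
From Pilot Require Import Defs.
From Stdlib Require Import Reals List Lra Lia Psatz Setoid Morphisms.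
From Coquelicot Require Import Coquelicot.
Import ListNotations.
(* Again, because [List] also has a [concat]. *)
Import Pilot.Defs.
Open Scope R_scope.

(** * Continuity of real and complex valued functions *)

(** Continuity is demanded on the whole space, so that it composes without side conditions. Data
    given only on the unit interval are first extended by [clamp]. *)
Definition contR {T : UniformSpace} (f : T -> R) : Prop :=
  forall q, @continuous T R_UniformSpace f q.
Definition contC {T : UniformSpace} (f : T -> C) : Prop :=
  forall q, @continuous T C_UniformSpace f q.
Definition contC2 (H : R -> R -> C) : Prop :=
  @contC (prod_UniformSpace R_UniformSpace R_UniformSpace) (fun q => H (fst q) (snd q)).

Section Continuity.
Context {T : UniformSpace}.
Implicit Types (f g : T -> R) (F G : T -> C).

Lemma contR_const (c : R) : contR (fun _ : T => c).
Proof. intro q; apply continuous_const. Qed.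

Lemma contR_plus f g : contR f -> contR g -> contR (fun q => f q + g q).
Proof. intros hf hg q; exact (@continuous_plus _ _ R_NormedModule f g q (hf q) (hg q)). Qed.

Lemma contR_opp f : contR f -> contR (fun q => - f q).
Proof. intros hf q; exact (@continuous_opp _ _ R_NormedModule f q (hf q)). Qed.

Lemma contR_minus f g : contR f -> contR g -> contR (fun q => f q - g q).
Proof. intros hf hg; apply contR_plus; [|apply contR_opp]; assumption. Qed.

Lemma contR_mult f g : contR f -> contR g -> contR (fun q => f q * g q).
Proof. intros hf hg q; exact (@continuous_mult _ R_AbsRing f g q (hf q) (hg q)). Qed.

Lemma contR_comp (h : R -> R) f : @contR R_UniformSpace h -> contR f -> contR (fun q => h (f q)).
Proof. intros hh hf q; apply continuous_comp; [apply hf | apply hh]. Qed.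

Lemma contR_div f (c : R) : contR f -> contR (fun q => f q / c).
Proof. intros hf; apply contR_mult; [assumption | apply contR_const]. Qed.

Lemma contR_Rmin f g : contR f -> contR g -> contR (fun q => Rmin (f q) (g q)).
Proof.
intros hf hg q.
apply continuous_ext with (fun q => (f q + g q - Rabs (f q - g q)) / 2).
- intro z; unfold Rmin, Rabs; destruct (Rle_dec _ _), (Rcase_abs _); lra.
- apply contR_div, contR_minus; [now apply contR_plus|].
  apply (contR_comp Rabs); [intro; apply continuous_Rabs | now apply contR_minus].
Qed.

Lemma contR_Rmax f g : contR f -> contR g -> contR (fun q => Rmax (f q) (g q)).
Proof.
intros hf hg q.
apply continuous_ext with (fun q => - Rmin (- f q) (- g q)).
- intro z; unfold Rmin, Rmax; destruct (Rle_dec _ _), (Rle_dec _ _); lra.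
- apply contR_opp, contR_Rmin; now apply contR_opp.
Qed.

Lemma contR_cos f : contR f -> contR (fun q => cos (f q)).
Proof. apply contR_comp; intro; apply continuous_cos. Qed.

Lemma contR_sin f : contR f -> contR (fun q => sin (f q)).
Proof. apply contR_comp; intro; apply continuous_sin. Qed.

Lemma contC_pair f g : contR f -> contR g -> contC (fun q => (f q, g q)).
Proof.
intros hf hg q P [e He].
assert (A : locally q (fun z => ball (f q) e (f z) /\ ball (g q) e (g z))).
{ apply filter_and; [exact (hf q _ (locally_ball (f q) e)) | exact (hg q _ (locally_ball (g q) e))]. }
unfold filtermap; revert A; apply filter_imp; intros z h; apply He, h.
Qed.

Lemma contR_fst F : contC F -> contR (fun q => fst (F q)).
Proof.
intros hF q; apply (continuous_comp F (fun z : C_UniformSpace => fst z)); [apply hF|].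
destruct (F q); apply (continuous_fst (U := R_UniformSpace) (V := R_UniformSpace)).
Qed.

Lemma contR_snd F : contC F -> contR (fun q => snd (F q)).
Proof.
intros hF q; apply (continuous_comp F (fun z : C_UniformSpace => snd z)); [apply hF|].
destruct (F q); apply (continuous_snd (U := R_UniformSpace) (V := R_UniformSpace)).
Qed.

Lemma contC_ext F G : (forall q, F q = G q) -> contC F -> contC G.
Proof. intros h hF q; apply (continuous_ext F); auto. Qed.

Lemma contC_const (c : C) : contC (fun _ : T => c).
Proof. intro q; apply continuous_const. Qed.

Lemma contC_RtoC f : contR f -> contC (fun q => RtoC (f q)).
Proof. intro hf; apply contC_pair; [assumption | apply contR_const]. Qed.

Lemma contC_cis f : contR f -> contC (fun q => cis (f q)).
Proof. intro hf; apply contC_pair; [now apply contR_cos | now apply contR_sin]. Qed.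

Lemma contC_plus F G : contC F -> contC G -> contC (fun q => (F q + G q)%C).
Proof.
intros hF hG.
exact (contC_pair _ _ (contR_plus _ _ (contR_fst F hF) (contR_fst G hG))
                      (contR_plus _ _ (contR_snd F hF) (contR_snd G hG))).
Qed.

Lemma contC_opp F : contC F -> contC (fun q => (- F q)%C).
Proof.
intros hF; exact (contC_pair _ _ (contR_opp _ (contR_fst F hF)) (contR_opp _ (contR_snd F hF))).
Qed.

Lemma contC_minus F G : contC F -> contC G -> contC (fun q => (F q - G q)%C).
Proof. intros hF hG; exact (contC_plus F _ hF (contC_opp G hG)). Qed.

Lemma contC_mult F G : contC F -> contC G -> contC (fun q => (F q * G q)%C).
Proof.
intros hF hG; generalize (contR_fst F hF) (contR_fst G hG) (contR_snd F hF) (contR_snd G hG).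
intros h1 h2 h3 h4.
exact (contC_pair _ _ (contR_minus _ _ (contR_mult _ _ h1 h2) (contR_mult _ _ h3 h4))
                      (contR_plus _ _ (contR_mult _ _ h1 h4) (contR_mult _ _ h3 h2))).
Qed.

Lemma contR_Cmod F : contC F -> contR (fun q => Cmod (F q)).
Proof.
intro hF; generalize (contR_fst F hF) (contR_snd F hF); intros h1 h2.
apply (contR_comp sqrt (fun q => fst (F q) * (fst (F q) * 1) + snd (F q) * (snd (F q) * 1))).
- intro z; apply continuous_sqrt.
- apply contR_plus; apply contR_mult; trivial; apply contR_mult; trivial; apply contR_const.
Qed.

Lemma contC_comp {V : UniformSpace} (G : V -> C) (h : T -> V) :
  contC G -> (forall q, continuous h q) -> contC (fun q => G (h q)).
Proof. intros hG hh q; apply (continuous_comp h G); [apply hh | apply hG]. Qed.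

Lemma contC_comp2 (H : R -> R -> C) f g :
  contC2 H -> contR f -> contR g -> contC (fun q => H (f q) (g q)).
Proof.
intros hH hf hg q; apply (continuous_comp_2 f g H); [apply hf | apply hg | apply hH].
Qed.

(** The bridge from [continuous_on] to continuity everywhere: [h] pushes every point into [P], in
    practice by clamping. *)
Lemma contC_on_comp {V : UniformSpace} (P : V -> Prop) (G : V -> C) (h : T -> V) :
  continuous_on P G -> (forall q, continuous h q) -> (forall q, P (h q)) ->
  contC (fun q => G (h q)).
Proof.
intros hG hh hP q.
unfold continuous; apply filterlim_comp with (2 := hG _ (hP q)).
intros A hA; unfold filtermap.
generalize (hh q _ hA); unfold filtermap, within; apply filter_imp.
intros z hz; apply hz, hP.
Qed.

End Continuity.

Lemma contR_id : @contR R_UniformSpace (fun t => t).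
Proof. intro q; apply continuous_id. Qed.

Lemma contC_id : @contC C_UniformSpace (fun z => z).
Proof. intro q; apply continuous_id. Qed.

Lemma contR_fst2 {U : UniformSpace} : @contR (prod_UniformSpace R_UniformSpace U) fst.
Proof. intros [a b]; apply continuous_fst. Qed.

Lemma contR_snd2 {U : UniformSpace} : @contR (prod_UniformSpace U R_UniformSpace) snd.
Proof. intros [a b]; apply continuous_snd. Qed.

Lemma contC_snd2 {U : UniformSpace} : @contC (prod_UniformSpace U C_UniformSpace) snd.
Proof. intros [a b]; apply continuous_snd. Qed.

Lemma contC_contR (F : R -> C) {T : UniformSpace} (f : T -> R) :
  @contC R_UniformSpace F -> contR f -> contC (fun q => F (f q)).
Proof. intros; now apply contC_comp. Qed.

(** The retraction of the line onto the unit interval, used to extend paths and homotopies to all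
    real parameters. *)
Definition clamp (t : R) : R := Rmax 0 (Rmin 1 t).

Lemma clamp_unit t : unit_I (clamp t).
Proof.
unfold unit_I, clamp; split; [apply Rmax_l|].
apply Rmax_lub; [lra | apply Rmin_l].
Qed.

Lemma clamp_id t : unit_I t -> clamp t = t.
Proof. intros [h1 h2]; unfold clamp; rewrite Rmin_right, Rmax_right; lra. Qed.

Lemma clamp_le0 t : t <= 0 -> clamp t = 0.
Proof. intros; unfold clamp; rewrite Rmin_right, Rmax_left; lra. Qed.

Lemma clamp_ge1 t : 1 <= t -> clamp t = 1.
Proof. intros; unfold clamp; rewrite Rmin_left, Rmax_right; lra. Qed.

Lemma contR_clamp {T : UniformSpace} (f : T -> R) : contR f -> contR (fun q => clamp (f q)).
Proof.
intros hf; apply contR_Rmax; [apply contR_const | apply contR_Rmin; [apply contR_const | exact hf]].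
Qed.

Lemma unit_0 : unit_I 0. Proof. unfold unit_I; lra. Qed.
Lemma unit_1 : unit_I 1. Proof. unfold unit_I; lra. Qed.
#[local] Hint Resolve unit_0 unit_1 clamp_unit : core.

(** * Arcs up to homotopy *)

(** The end points belong to the type, as in a fundamental groupoid, so only composable arcs can be
    multiplied. Continuity holds on the whole line, but the values lie in [X] only over the unit
    interval. *)
Record Arc (X : C -> Prop) (a b : C) : Type := mkArc {
  fn :> R -> C;
  fn_cont : @contC R_UniformSpace fn;
  fn_in : forall t, unit_I t -> X (fn t);
  fn_0 : fn 0 = a;
  fn_1 : fn 1 = b }.
Arguments mkArc {X a b}.
Arguments fn {X a b}.
Arguments fn_cont {X a b}.
Arguments fn_in {X a b}.
Arguments fn_0 {X a b}.
Arguments fn_1 {X a b}.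

Ltac cont :=
  lazymatch goal with
  | |- contC2 _ => unfold contC2; cont
  | |- contR (fun _ => ?c) => apply (contR_const c)
  | |- contR (fun q => q) => apply contR_id
  | |- contR (fun q => fst q) => apply contR_fst2
  | |- contR (fun q => snd q) => apply contR_snd2
  | |- contR (fun q => @?f q + @?g q) => apply (contR_plus f g); cont
  | |- contR (fun q => @?f q - @?g q) => apply (contR_minus f g); cont
  | |- contR (fun q => @?f q * @?g q) => apply (contR_mult f g); cont
  | |- contR (fun q => @?f q / ?c) => apply (contR_div f c); cont
  | |- contR (fun q => - @?f q) => apply (contR_opp f); cont
  | |- contR (fun q => Rmin (@?f q) (@?g q)) => apply (contR_Rmin f g); cont
  | |- contR (fun q => Rmax (@?f q) (@?g q)) => apply (contR_Rmax f g); cont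
  | |- contR (fun q => clamp (@?f q)) => apply (contR_clamp f); cont
  | |- contR (fun q => Cmod (@?f q)) => apply (contR_Cmod f); cont
  | |- contR (fun q => fst (@?f q)) => apply (contR_fst f); cont
  | |- contR (fun q => snd (@?f q)) => apply (contR_snd f); cont
  | h : contR ?f |- contR (fun q => ?f (@?g q)) => apply (contR_comp f g h); cont
  | |- contC (fun _ => ?c) => apply (contC_const c)
  | |- contC (fun q => q) => apply contC_id
  | |- contC (fun q => snd q) => apply contC_snd2
  | |- contC (fun q => (@?f q + @?g q)%C) => apply (contC_plus f g); cont
  | |- contC (fun q => (@?f q - @?g q)%C) => apply (contC_minus f g); cont
  | |- contC (fun q => (@?f q * @?g q)%C) => apply (contC_mult f g); cont
  | |- contC (fun q => (- @?f q)%C) => apply (contC_opp f); cont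
  | |- contC (fun q => RtoC (@?f q)) => apply (contC_RtoC f); cont
  | |- contC (fun q => cis (@?f q)) => apply (contC_cis f); cont
  | |- contC (fun q => (@?f q, @?g q)) => apply (contC_pair f g); cont
  | |- contC (fun q => fn ?f (@?g q)) => apply (contC_contR (fn f) g (fn_cont f)); cont
  | h : contC2 ?H |- contC (fun q => ?H (@?f q) (@?g q)) => apply (contC_comp2 H f g h); cont
  | h : contC ?F |- contC (fun q => ?F (@?g q)) => apply (contC_contR F g h); cont
  | _ => idtac
  end.

Definition hom {X a b} (f g : Arc X a b) : Prop :=
  exists H : R -> R -> C,
    contC2 H /\
    (forall s t, unit_I s -> unit_I t -> X (H s t)) /\
    (forall s, unit_I s -> H s 0 = a /\ H s 1 = b) /\
    (forall t, unit_I t -> H 0 t = f t /\ H 1 t = g t).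

Lemma concat_cont (f g : R -> C) :
  @contC R_UniformSpace f -> @contC R_UniformSpace g -> f 1 = g 0 ->
  @contC R_UniformSpace (concat f g).
Proof.
intros hf hg e.
(* A formula for [concat] without cases: at each time one of the two terms rests at the junction,
   whose value [g 0] is subtracted. *)
apply (contC_ext (fun t => f (Rmin (2 * t) 1) + g (Rmax (2 * t - 1) 0) - g 0)%C).
- intro t; unfold concat; destruct (Rle_dec _ _).
  + rewrite Rmin_left, Rmax_right by lra; ring.
  + rewrite Rmin_right, Rmax_left by lra; rewrite e; ring.
- cont.
Qed.

Lemma concat_in (X : C -> Prop) (f g : R -> C) :
  (forall t, unit_I t -> X (f t)) -> (forall t, unit_I t -> X (g t)) ->
  forall t, unit_I t -> X (concat f g t).
Proof.
intros hf hg t [h1 h2]; unfold concat; destruct (Rle_dec _ _); [apply hf | apply hg]; split; lra.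
Qed.

Lemma concat_0 (f g : R -> C) : concat f g 0 = f 0.
Proof. unfold concat; destruct (Rle_dec _ _); [f_equal; lra | lra]. Qed.

Lemma concat_1 (f g : R -> C) : concat f g 1 = g 1.
Proof. unfold concat; destruct (Rle_dec _ _); [lra | f_equal; lra]. Qed.

Definition acat {X a b c} (f : Arc X a b) (g : Arc X b c) : Arc X a c.
Proof.
refine (mkArc (concat f g) _ _ _ _).
- apply concat_cont; try apply fn_cont; now rewrite fn_0, fn_1.
- apply concat_in; apply fn_in.
- rewrite concat_0; apply fn_0.
- rewrite concat_1; apply fn_1.
Defined.

Definition ainv {X a b} (f : Arc X a b) : Arc X b a.
Proof.
refine (mkArc (inverse f) _ _ _ _); unfold inverse.
- cont.
- intros t [h1 h2]; apply fn_in; split; lra.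
- rewrite Rminus_0_r; apply fn_1.
- rewrite Rminus_diag; apply fn_0.
Defined.

Definition aone {X a} (h : X a) : Arc X a a :=
  mkArc (fun _ => a) (contC_const a) (fun _ _ => h) eq_refl eq_refl.

#[local] Infix "~~" := hom (at level 70).
#[local] Infix ";;" := acat (at level 55, right associativity).
#[local] Notation "! f" := (ainv f) (at level 35, right associativity).

Section Homotopy.
Context {X : C -> Prop}.

(** Two arcs that factor through the square and there have the same end points are homotopic,
    because the square is convex. *)
Lemma hom_square {a b} (f g : Arc X a b) (F : R -> R -> C) (p1 p2 q1 q2 : R -> R) :
  contC2 F -> (forall s t, unit_I s -> unit_I t -> X (F s t)) ->
  @contR R_UniformSpace p1 -> @contR R_UniformSpace p2 ->
  @contR R_UniformSpace q1 -> @contR R_UniformSpace q2 ->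
  (forall t, unit_I t -> unit_I (p1 t) /\ unit_I (p2 t) /\ unit_I (q1 t) /\ unit_I (q2 t)) ->
  p1 0 = q1 0 -> p2 0 = q2 0 -> p1 1 = q1 1 -> p2 1 = q2 1 ->
  (forall t, unit_I t -> F (p1 t) (p2 t) = f t) ->
  (forall t, unit_I t -> F (q1 t) (q2 t) = g t) ->
  f ~~ g.
Proof.
intros hF hX c1 c2 c3 c4 hu e1 e2 e3 e4 hf hg.
exists (fun s t => F ((1 - s) * p1 t + s * q1 t) ((1 - s) * p2 t + s * q2 t)).
assert (conv : forall s x y, unit_I s -> unit_I x -> unit_I y -> unit_I ((1 - s) * x + s * y)).
{ unfold unit_I; intros; split; nra. }
split; [|split; [|split]].
- cont.
- intros s t hs ht; destruct (hu t ht) as (?&?&?&?); apply hX; now apply conv.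
- intros s hs; rewrite <- e1, <- e2, <- e3, <- e4.
  replace ((1 - s) * p1 0 + s * p1 0) with (p1 0) by ring.
  replace ((1 - s) * p2 0 + s * p2 0) with (p2 0) by ring.
  replace ((1 - s) * p1 1 + s * p1 1) with (p1 1) by ring.
  replace ((1 - s) * p2 1 + s * p2 1) with (p2 1) by ring.
  rewrite !hf by trivial; split; [apply fn_0 | apply fn_1].
- intros t ht; rewrite <- hf, <- hg by trivial; split; f_equal; ring.
Qed.

(** Two ways of running along the same arc [h] differ by a homotopy of the parameter alone. This
    yields the groupoid laws below. *)
Lemma hom_reparam {a b a' b'} (h : Arc X a' b') (f g : Arc X a b) (p q : R -> R) :
  @contR R_UniformSpace p -> @contR R_UniformSpace q ->
  (forall t, unit_I t -> unit_I (p t)) -> (forall t, unit_I t -> unit_I (q t)) ->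
  p 0 = q 0 -> p 1 = q 1 ->
  (forall t, unit_I t -> f t = h (p t)) ->
  (forall t, unit_I t -> g t = h (q t)) ->
  f ~~ g.
Proof.
intros cp cq up uq e0 e1 hf hg.
apply (hom_square f g (fun s _ => h s) p p q q); auto.
- cont.
- intros; now apply fn_in.
- intros; now rewrite hf.
- intros; now rewrite hg.
Qed.

Lemma hom_ext {a b} (f g : Arc X a b) : (forall t, unit_I t -> f t = g t) -> f ~~ g.
Proof.
intro e; apply (hom_reparam f f g (fun t => t) (fun t => t)); auto; try cont.
intros; now rewrite e.
Qed.

Lemma hom_refl {a b} (f : Arc X a b) : f ~~ f.
Proof. now apply hom_ext. Qed.

Lemma hom_sym {a b} (f g : Arc X a b) : f ~~ g -> g ~~ f.
Proof.
intros (H & hc & hX & he & hfg).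
exists (fun s t => H (1 - s) t); split; [|split; [|split]].
- cont.
- intros s t [? ?] ?; apply hX; trivial; split; lra.
- intros s [? ?]; apply he; split; lra.
- intros t ht; rewrite Rminus_0_r, Rminus_diag; split; now apply hfg.
Qed.

Lemma hom_trans {a b} (f g h : Arc X a b) : f ~~ g -> g ~~ h -> f ~~ h.
Proof.
intros (H & hc & hX & he & hfg) (K & kc & kX & ke & kfg).
assert (eL : forall s t, s <= 1/2 -> unit_I t ->
  (H (clamp (2 * s)) t + K (clamp (2 * s - 1)) t - g t = H (clamp (2 * s)) t)%C).
{ intros s t hs ht; rewrite (clamp_le0 (2 * s - 1)) by lra.
  rewrite (proj1 (kfg t ht)); ring. }
assert (eR : forall s t, 1/2 <= s -> unit_I t ->
  (H (clamp (2 * s)) t + K (clamp (2 * s - 1)) t - g t = K (clamp (2 * s - 1)) t)%C).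
{ intros s t hs ht; rewrite (clamp_ge1 (2 * s)) by lra.
  rewrite (proj2 (hfg t ht)); ring. }
(* The two homotopies are glued without cases: on each half of the time one of them rests at the
   common stage [g], which is subtracted. *)
exists (fun s t => H (clamp (2 * s)) t + K (clamp (2 * s - 1)) t - g t)%C.
split; [|split; [|split]].
- cont.
- intros s t hs ht; destruct (Rle_dec s (1/2)).
  + rewrite eL by trivial; now apply hX.
  + rewrite eR by (trivial; lra); now apply kX.
- intros s hs; destruct (Rle_dec s (1/2)).
  + rewrite !eL by trivial; now apply he.
  + rewrite !eR by (trivial; lra); now apply ke.
- intros t ht; rewrite eL, eR by (trivial; lra); split.
  + rewrite clamp_le0 by lra; now apply hfg.
  + rewrite clamp_ge1 by lra; now apply kfg.
Qed.

#[global] Instance hom_equivalence {a b} : Equivalence (@hom X a b).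
Proof.
split; [exact hom_refl | exact hom_sym | exact hom_trans].
Qed.

Lemma hom_acat {a b c} (f f' : Arc X a b) (g g' : Arc X b c) :
  f ~~ f' -> g ~~ g' -> f ;; g ~~ f' ;; g'.
Proof.
intros (H & hc & hX & he & hfg) (K & kc & kX & ke & kfg).
(* For fixed [s] this is the concatenation of the two stages, again written as a sum minus the value
   [b] at the junction. *)
set (G := fun s t => (H (clamp s) (Rmin (2 * t) 1) + K (clamp s) (Rmax (2 * t - 1) 0) - b)%C).
assert (eG : forall s t, G s t = concat (H (clamp s)) (K (clamp s)) t).
{ intros s t; unfold G, concat; destruct (Rle_dec _ _).
  - rewrite Rmin_left, Rmax_right by lra; rewrite (proj1 (ke _ (clamp_unit s))); ring.
  - rewrite Rmin_right, Rmax_left by lra; rewrite (proj2 (he _ (clamp_unit s))); ring. }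
exists G; split; [|split; [|split]].
- unfold G; cont.
- intros s t hs ht; rewrite eG; apply concat_in; auto.
- intros s hs; rewrite !eG, concat_0, concat_1; split; [now apply he | now apply ke].
- intros t [h1 h2]; rewrite !eG, (clamp_id 0), (clamp_id 1) by trivial.
  unfold acat; simpl; unfold concat; destruct (Rle_dec _ _).
  + apply hfg; split; lra.
  + apply kfg; split; lra.
Qed.

#[global] Instance acat_Proper {a b c} : Proper (hom ==> hom ==> hom) (@acat X a b c).
Proof. intros f f' hf g g' hg; now apply hom_acat. Qed.

#[global] Instance ainv_Proper {a b} : Proper (hom ==> hom) (@ainv X a b).
Proof.
intros f g (H & hc & hX & he & hfg).
exists (fun s t => H s (1 - t)); split; [|split; [|split]].
- cont.
- intros s t ? [? ?]; apply hX; trivial; split; lra.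
- intros s hs; rewrite Rminus_0_r, Rminus_diag; split; now apply he.
- intros t [? ?]; apply hfg; split; lra.
Qed.

Lemma acat_assoc {a b c d} (f : Arc X a b) (g : Arc X b c) (h : Arc X c d) :
  (f ;; g) ;; h ~~ f ;; g ;; h.
Proof.
(* The convex piecewise linear map with slopes 1/2, 1 and 2 turns the break points 1/2, 3/4 of the
   right-hand product into the break points 1/4, 1/2 of the left-hand one. *)
apply (hom_reparam ((f ;; g) ;; h) _ _ (fun t => t)
         (fun t => Rmax (t / 2) (Rmax (t - 1/4) (2 * t - 1)))); cont; auto.
- intros t [? ?]; split.
  + apply Rle_trans with (t/2); [lra | apply Rmax_l].
  + repeat apply Rmax_lub; lra.
- rewrite Rmax_left; [lra | apply Rmax_lub; lra].
- rewrite (Rmax_right (1 - 1/4)), Rmax_right by lra; lra.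
- intros t [? ?]; simpl; unfold concat.
  destruct (Rle_dec t (1/2)).
  + rewrite (Rmax_left (t/2)) by (apply Rmax_lub; lra).
    destruct (Rle_dec _ _); [|lra]; destruct (Rle_dec _ _); [|lra]; f_equal; lra.
  + destruct (Rle_dec (2 * t - 1) (1/2)).
    * rewrite (Rmax_left (t - 1/4)), Rmax_right by lra.
      destruct (Rle_dec _ _); [|lra]; destruct (Rle_dec _ _); [lra|]; f_equal; lra.
    * rewrite (Rmax_right (t - 1/4)), Rmax_right by lra.
      destruct (Rle_dec _ _); [lra|]; f_equal; lra.
Qed.

Lemma aone_l {a b} (h : X a) (f : Arc X a b) : aone h ;; f ~~ f.
Proof.
apply (hom_reparam f _ _ (fun t => Rmax 0 (2 * t - 1)) (fun t => t)); cont; auto.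
- intros t [? ?]; split; [apply Rmax_l | apply Rmax_lub; lra].
- rewrite Rmax_left; lra.
- rewrite Rmax_right; lra.
- intros t [? ?]; simpl; unfold concat; destruct (Rle_dec _ _).
  + rewrite Rmax_left, fn_0 by lra; reflexivity.
  + rewrite Rmax_right by lra; reflexivity.
Qed.

Lemma aone_r {a b} (h : X b) (f : Arc X a b) : f ;; aone h ~~ f.
Proof.
apply (hom_reparam f _ _ (fun t => Rmin 1 (2 * t)) (fun t => t)); cont; auto.
- intros t [? ?]; split; [apply Rmin_glb; lra | apply Rmin_l].
- rewrite Rmin_right; lra.
- rewrite Rmin_left; lra.
- intros t [? ?]; simpl; unfold concat; destruct (Rle_dec _ _).
  + rewrite Rmin_right by lra; reflexivity.
  + rewrite Rmin_left, fn_1 by lra; reflexivity.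
Qed.

Lemma ainv_r {a b} (h : X a) (f : Arc X a b) : f ;; ! f ~~ aone h.
Proof.
(* Running out and back is [f] along a tent function, which has the same end values as the constant
   0. *)
apply (hom_reparam f _ _ (fun t => Rmin (2 * t) (2 - 2 * t)) (fun _ => 0)); cont; auto.
- intros t [? ?]; split; [apply Rmin_glb; lra|].
  unfold Rmin; destruct (Rle_dec _ _); lra.
- rewrite Rmin_left; lra.
- rewrite Rmin_right; lra.
- intros t [? ?]; simpl; unfold concat, inverse; destruct (Rle_dec _ _).
  + rewrite Rmin_left by lra; reflexivity.
  + rewrite Rmin_right by lra; f_equal; lra.
- intros; simpl; now rewrite fn_0.
Qed.

Lemma ainv_inv {a b} (f : Arc X a b) : ! ! f ~~ f.
Proof. apply hom_ext; intros t _; simpl; unfold inverse; f_equal; lra. Qed.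

Lemma ainv_l {a b} (h : X b) (f : Arc X a b) : ! f ;; f ~~ aone h.
Proof. rewrite <- (ainv_inv f) at 2; apply ainv_r. Qed.

Lemma ainv_cat {a b c} (f : Arc X a b) (g : Arc X b c) : ! (f ;; g) ~~ ! g ;; ! f.
Proof.
apply hom_ext; intros t _; simpl; unfold inverse, concat.
destruct (Rle_dec (1 - t) (1/2)), (Rle_dec t (1/2)); try lra; try (f_equal; lra).
(* Only the time 1/2 is left, where both sides are at the junction of [f] and [g]. *)
replace (2 * (1 - t)) with 1 by lra; replace (1 - 2 * t) with 0 by lra.
now rewrite fn_0, fn_1.
Qed.

Lemma fn_start {a b} (f : Arc X a b) : X a.
Proof. rewrite <- (fn_0 f); now apply fn_in. Qed.

Lemma fn_end {a b} (f : Arc X a b) : X b.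
Proof. rewrite <- (fn_1 f); now apply fn_in. Qed.

Lemma acat_invK {a b c} (f : Arc X a b) (g : Arc X a c) : f ;; ! f ;; g ~~ g.
Proof. rewrite <- acat_assoc, (ainv_r (fn_start f)); apply aone_l. Qed.

Lemma ainv_catK {a b c} (f : Arc X b a) (g : Arc X a c) : ! f ;; f ;; g ~~ g.
Proof. rewrite <- acat_assoc, (ainv_l (fn_end f)); apply aone_l. Qed.

End Homotopy.

(** * Segments, free homotopies, star-shaped regions and induced maps on arcs *)

Lemma segment_0 a b : segment a b 0 = a.
Proof. unfold segment; ring. Qed.

Lemma segment_1 a b : segment a b 1 = b.
Proof. unfold segment; ring. Qed.

Lemma segment_cont a b : @contC R_UniformSpace (segment a b).
Proof. unfold segment; cont. Qed.

Section Free.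
Context {X : C -> Prop}.

Definition aseg {a b} (h : forall t, unit_I t -> X (segment a b t)) : Arc X a b :=
  mkArc (segment a b) (segment_cont a b) h (segment_0 a b) (segment_1 a b).

(** When the end points move along [l] and [r], the two products are the images of the two ways
    around the boundary of the square, so [hom_square] applies. *)
Lemma hom_free {a b c d} (F : R -> R -> C) (f : Arc X a b) (g : Arc X c d)
    (l : Arc X a c) (r : Arc X b d) :
  contC2 F -> (forall s t, unit_I s -> unit_I t -> X (F s t)) ->
  (forall t, unit_I t -> F 0 t = f t) -> (forall t, unit_I t -> F 1 t = g t) ->
  (forall s, unit_I s -> F s 0 = l s) -> (forall s, unit_I s -> F s 1 = r s) ->
  f ;; r ~~ l ;; g.
Proof.
intros hF hX h0 h1 hl hr.
assert (u1 : forall t, unit_I t -> unit_I (Rmax 0 (2 * t - 1))).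
{ intros t [? ?]; split; [apply Rmax_l | apply Rmax_lub; lra]. }
assert (u2 : forall t, unit_I t -> unit_I (Rmin 1 (2 * t))).
{ intros t [? ?]; split; [apply Rmin_glb; lra | apply Rmin_l]. }
apply (hom_square _ _ F (fun t => Rmax 0 (2 * t - 1)) (fun t => Rmin 1 (2 * t))
         (fun t => Rmin 1 (2 * t)) (fun t => Rmax 0 (2 * t - 1))); auto; try (cont; fail).
- rewrite Rmax_left, Rmin_right; lra.
- rewrite Rmax_left, Rmin_right; lra.
- rewrite Rmax_right, Rmin_left; lra.
- rewrite Rmax_right, Rmin_left; lra.
- intros t [? ?]; simpl; unfold concat; destruct (Rle_dec _ _).
  + rewrite Rmax_left, Rmin_right by lra; apply h0; split; lra.
  + rewrite Rmax_right, Rmin_left by lra; apply hr; split; lra.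
- intros t [? ?]; simpl; unfold concat; destruct (Rle_dec _ _).
  + rewrite Rmax_left, Rmin_right by lra; apply hl; split; lra.
  + rewrite Rmax_right, Rmin_left by lra; apply h1; split; lra.
Qed.

Definition along (V : C -> Prop) {a b} (f : Arc X a b) : Prop :=
  forall t, unit_I t -> V (f t).

Lemma along_cat V {a b c} (f : Arc X a b) (g : Arc X b c) :
  along V f -> along V g -> along V (f ;; g).
Proof. intros hf hg; exact (concat_in V f g hf hg). Qed.

Lemma along_inv V {a b} (f : Arc X a b) : along V f -> along V (! f).
Proof. intros h t [? ?]; apply h; split; lra. Qed.

(** The segments towards [q] have to stay in the ambient [X] only, not in [V]. *)
Definition star (V : C -> Prop) (q : C) : Prop :=
  forall y s, V y -> unit_I s -> X (segment y q s).

(** Contraction along segments to [q] is a free homotopy from each arc in [V] to a constant one. The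
    tracks of its ends depend only on [a] and [b], so they cancel when two arcs are compared. *)
Lemma hom_star {a b} V q (f g : Arc X a b) : star V q -> along V f -> along V g -> f ~~ g.
Proof.
intros st hf hg.
assert (ha : forall s, unit_I s -> X (segment a q s)).
{ intros s hs; rewrite <- (fn_0 f); apply st; trivial; now apply hf. }
assert (hb : forall s, unit_I s -> X (segment b q s)).
{ intros s hs; rewrite <- (fn_1 f); apply st; trivial; now apply hf. }
assert (hq : X q) by (generalize (ha 1 unit_1); now rewrite segment_1).
assert (key : forall k : Arc X a b, along V k -> k ;; aseg hb ~~ aseg ha ;; aone hq).
{ intros k hk; apply (hom_free (fun s t => segment (k t) q s)).
  - unfold segment; cont.
  - intros s t hs ht; apply st; trivial; now apply hk.
  - intros; apply segment_0.
  - intros; apply segment_1.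
  - intros; now rewrite fn_0.
  - intros; now rewrite fn_1. }
assert (eq : f ;; aseg hb ~~ g ;; aseg hb) by (rewrite (key f hf), (key g hg); reflexivity).
rewrite <- (aone_r (fn_end f) f), <- (ainv_r (fn_end f) (aseg hb)), <- acat_assoc, eq.
now rewrite acat_assoc, (ainv_r (fn_end f)), aone_r.
Qed.

Definition amap (phi : C -> C) (hc : contC phi) (hX : forall y, X y -> X (phi y))
  {a b} (ha : phi a = a) (hb : phi b = b) (f : Arc X a b) : Arc X a b.
Proof.
refine (mkArc (fun t => phi (f t)) _ _ _ _).
- apply (contC_comp phi f); [exact hc | apply fn_cont].
- intros; now apply hX, fn_in.
- now rewrite fn_0.
- now rewrite fn_1.
Defined.

Section Map.
Context (phi : C -> C) (hc : contC phi) (hX : forall y, X y -> X (phi y)).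

#[global] Instance amap_Proper {a b} (ha : phi a = a) (hb : phi b = b) :
  Proper (hom ==> hom) (amap phi hc hX ha hb).
Proof.
intros f g (H & c & hH & he & hfg).
exists (fun s t => phi (H s t)); split; [|split; [|split]].
- unfold contC2; apply (contC_comp phi (fun q => H (fst q) (snd q))); [exact hc | apply c].
- auto.
- intros s hs; destruct (he s hs) as [-> ->]; auto.
- intros t ht; destruct (hfg t ht) as [-> ->]; auto.
Qed.

Lemma amap_cat {a b c} (ha : phi a = a) (hb : phi b = b) (h : phi c = c)
    (f : Arc X a b) (g : Arc X b c) :
  amap phi hc hX ha h (f ;; g) ~~ amap phi hc hX ha hb f ;; amap phi hc hX hb h g.
Proof.
apply hom_ext; intros t _; simpl; unfold concat; now destruct (Rle_dec _ _).
Qed.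

Lemma amap_inv {a b} (ha : phi a = a) (hb : phi b = b) (f : Arc X a b) :
  amap phi hc hX hb ha (! f) ~~ ! amap phi hc hX ha hb f.
Proof. now apply hom_ext. Qed.

Lemma amap_along {a b} (ha : phi a = a) (hb : phi b = b) (f : Arc X a b) :
  along (fun y => phi y = y) f -> amap phi hc hX ha hb f ~~ f.
Proof. intro h; now apply hom_ext. Qed.

End Map.
End Free.

(** * Rotations and the punctured disk *)

Lemma cis_plus a b : (cis a * cis b = cis (a + b))%C.
Proof. unfold cis, Cmult; simpl; rewrite cos_plus, sin_plus; f_equal; ring. Qed.

Lemma cis_0 : cis 0 = 1.
Proof. unfold cis; now rewrite cos_0, sin_0. Qed.

Lemma cis_2PI : cis (2 * PI) = 1.
Proof. unfold cis; now rewrite cos_2PI, sin_2PI. Qed.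

Lemma cis_PI : cis PI = -1.
Proof. unfold cis; now rewrite cos_PI, sin_PI. Qed.

Lemma Cmod_cis a : Cmod (cis a) = 1.
Proof.
unfold Cmod, cis; simpl fst; simpl snd.
replace (cos a ^ 2 + sin a ^ 2) with 1; [apply sqrt_1|].
generalize (sin2_cos2 a); unfold Rsqr; lra.
Qed.

Definition rot (phi : R -> R) (y : C) : C := (y * cis (phi (Cmod y)))%C.

Lemma Cmod_rot phi y : Cmod (rot phi y) = Cmod y.
Proof. unfold rot; rewrite Cmod_mult, Cmod_cis; ring. Qed.

Lemma rot_rot phi psi y : rot phi (rot psi y) = rot (fun r => phi r + psi r) y.
Proof.
unfold rot at 1; rewrite Cmod_rot; unfold rot.
rewrite <- Cmult_assoc, cis_plus; do 2 f_equal; ring.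
Qed.

Lemma rot_fix phi y : cis (phi (Cmod y)) = 1 -> rot phi y = y.
Proof. intro e; unfold rot; rewrite e; ring. Qed.

Lemma Cmod_sqr z : Cmod z ^ 2 = fst z ^ 2 + snd z ^ 2.
Proof.
unfold Cmod; rewrite pow2_sqrt; [reflexivity | apply Rplus_le_le_0_compat; apply pow2_ge_0].
Qed.

Lemma Cmod_le z r : 0 <= r -> (Cmod z <= r <-> fst z ^ 2 + snd z ^ 2 <= r ^ 2).
Proof.
intro hr; rewrite <- Cmod_sqr; split; intro h.
- apply pow_incr; split; [apply Cmod_ge_0 | exact h].
- apply Rsqr_incr_0; unfold Rsqr; [simpl in h; lra | apply Cmod_ge_0 | exact hr].
Qed.

Lemma Cmod_eq z r : 0 <= r -> (Cmod z = r <-> fst z ^ 2 + snd z ^ 2 = r ^ 2).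
Proof.
intro hr; rewrite <- Cmod_sqr; split; intro h; [now rewrite h|].
apply Rsqr_inj; unfold Rsqr; [apply Cmod_ge_0 | exact hr | simpl in h; lra].
Qed.

(** * The punctured disk, the gaps between its punctures and the arcs through them *)

Definition puncture (y : C) : Prop :=
  snd y = 0 /\ (fst y = -2 \/ fst y = -1 \/ fst y = 1 \/ fst y = 2).

Definition XD (y : C) : Prop := disk_D y /\ ~ puncture y.

Definition gap (lo hi : R) : Prop := forall k, puncture (RtoC k) -> k <= lo \/ hi <= k.

Definition slit (lo hi : R) (y : C) : Prop := disk_D y /\ (snd y <> 0 \/ lo < fst y < hi).

Lemma disk_segment y z s : disk_D y -> disk_D z -> unit_I s -> disk_D (segment y z s).
Proof.
intros hy hz [h0 h1]; unfold disk_D in *.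
replace (segment y z s) with (RtoC (1 - s) * y + RtoC s * z)%C
  by (unfold segment; rewrite RtoC_minus; ring).
eapply Rle_trans; [apply Cmod_triangle|].
rewrite !Cmod_mult, !Cmod_R, !Rabs_pos_eq by lra; nra.
Qed.

Lemma slit_XD lo hi y : gap lo hi -> slit lo hi y -> XD y.
Proof.
intros g [hd h]; split; trivial; intros [h0 h1].
destruct h as [h | h]; [lra|].
destruct (g (fst y)); try lra; now split.
Qed.

(** Moving towards the real point [q] scales the imaginary part by [1 - s], so a point off the axis
    reaches the axis only at [q] itself, and a point of the interval stays in it by convexity. *)
Lemma slit_star lo hi q : gap lo hi -> lo < q < hi -> -4 <= q <= 4 ->
  star (X := XD) (slit lo hi) q.
Proof.
intros g hq hq' y s [hd h] hs.
apply (slit_XD lo hi); trivial; split.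
- apply disk_segment; trivial; unfold disk_D; rewrite Cmod_R; apply Rabs_le; lra.
- unfold segment; simpl; destruct hs as [h0 h1].
  destruct (Req_dec s 1) as [-> | ns]; [right; lra|].
  destruct (Req_dec (snd y) 0) as [e | ne].
  + right; destruct h as [h | h]; [lra|]; nra.
  + left; nra.
Qed.

Definition top : C := (0, 4).

(** The punctures are [mark 1, ..., mark 4]; the outer values only bound the two unbounded gaps. *)
Definition mark (k : nat) : R :=
  match k with
  | 0%nat => -5 | 1%nat => -2 | 2%nat => -1 | 3%nat => 1 | 4%nat => 2 | _ => 5
  end.

Definition gate (k : nat) : R :=
  match k with
  | 0%nat => -3 | 1%nat => -3/2 | 2%nat => 0 | 3%nat => 3/2 | _ => 3
  end.

Definition slitk (k : nat) : C -> Prop := slit (mark k) (mark (S k)).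

Ltac cases5 k :=
  let h := fresh in
  assert (h : (k = 0 \/ k = 1 \/ k = 2 \/ k = 3 \/ k = 4)%nat) by lia;
  destruct h as [h | [h | [h | [h | h]]]]; rewrite h; simpl.

Lemma gap_mark k : gap (mark k) (mark (S k)).
Proof.
intros x [_ h]; simpl in h.
do 5 (destruct k as [|k]; [simpl; lra|]); simpl; lra.
Qed.

Lemma gate_mark k : (k <= 4)%nat -> mark k < gate k < mark (S k).
Proof. intro; cases5 k; lra. Qed.

Lemma slitk_star k : (k <= 4)%nat -> star (X := XD) (slitk k) (gate k).
Proof.
intro h; apply slit_star; [apply gap_mark | now apply gate_mark|].
cases5 k; lra.
Qed.

Lemma off_axis_slit lo hi y : disk_D y -> snd y <> 0 -> slit lo hi y.
Proof. intros hd h; split; auto. Qed.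

Lemma segment_gate_slit k y t : disk_D y -> snd y <> 0 -> unit_I t ->
  (k <= 4)%nat -> slitk k (segment y (gate k) t).
Proof.
intros hd h ht hk; split.
- apply disk_segment; trivial; unfold disk_D; rewrite Cmod_R; apply Rabs_le.
  cases5 k; lra.
- destruct (Req_dec t 1) as [-> | n].
  + right; rewrite segment_1; simpl; now apply gate_mark.
  + left; unfold segment; simpl; intro e; apply h; destruct ht; nra.
Qed.

(** The cap [min k 4] makes [cross] defined for every natural number. *)
Lemma segment_gate_XD k y : disk_D y -> snd y <> 0 ->
  forall t, unit_I t -> XD (segment y (gate (min k 4)) t).
Proof.
intros hd h t ht; apply (slit_XD (mark (min k 4)) (mark (S (min k 4)))); [apply gap_mark|].
apply segment_gate_slit; trivial; lia.
Qed.

Lemma u0_disk : disk_D u0.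
Proof. apply Cmod_le; simpl; lra. Qed.

Lemma top_disk : disk_D top.
Proof. apply Cmod_le; simpl; lra. Qed.

Lemma u0_off : snd u0 <> 0. Proof. simpl; lra. Qed.
Lemma top_off : snd top <> 0. Proof. simpl; lra. Qed.

(** From [u0] to [top] through the [k]-th gap between the punctures. *)
Definition cross (k : nat) : Arc XD u0 top :=
  aseg (segment_gate_XD k u0 u0_disk u0_off) ;; ! aseg (segment_gate_XD k top top_disk top_off).

Lemma cross_along k : (k <= 4)%nat -> along (slitk k) (cross k).
Proof.
intro hk; assert (e : min k 4 = k) by lia.
apply along_cat; [|apply along_inv]; intros t ht; simpl fn; rewrite e;
  apply segment_gate_slit; trivial; auto using u0_disk, top_disk, u0_off, top_off.
Qed.

Lemma off_axis_XD y : disk_D y -> snd y <> 0 -> XD y.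
Proof. intros hd h; split; trivial; intros [? _]; contradiction. Qed.

Lemma segment_up (y : C) : disk_D y -> 0 < snd y ->
  forall t, unit_I t -> disk_D (segment y top t) /\ 0 < snd (segment y top t).
Proof.
intros hd hy t ht; split; [apply disk_segment; auto using top_disk|].
unfold segment; simpl; destruct ht; nra.
Qed.

(** A vector from the lower half plane, turned counterclockwise by at most half a turn, can meet the
    real axis only on the positive side. *)
Lemma half_circle v a : snd v < 0 -> 0 <= a <= PI ->
  snd (v * cis a)%C = 0 -> fst (v * cis a)%C = Cmod v.
Proof.
intros hv ha h0.
symmetry; replace (Cmod v) with (Cmod (v * cis a)%C) by (rewrite Cmod_mult, Cmod_cis; ring).
assert (hs : 0 <= sin a) by (apply sin_ge_0; lra).
generalize (sin2_cos2 a); unfold Rsqr; intro sc.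
apply Cmod_eq; [|rewrite h0; ring].
unfold cis in *; simpl in *.
(* The sign of the real part shows after multiplication by [- snd v]: where the imaginary part
   vanishes, the product is [sin a] times the squared modulus of [v]. *)
apply Rmult_le_reg_r with (- snd v); [lra|].
replace ((fst v * cos a - snd v * sin a) * - snd v)
  with (sin a * (fst v ^ 2 + snd v ^ 2) - fst v * (fst v * sin a + snd v * cos a)) by ring.
rewrite h0; nra.
Qed.

(** The circle is cut at the point opposite to its start, which is joined to [top] inside the upper
    half plane. The first half meets the axis only at [p + Cmod v], in gap [i], and the second half,
    run backwards, only at [p - Cmod v], in gap [j]. With tail and link added, each half becomes a
    crossing arc by [hom_star]. *)
Lemma circle_split (p : R) (v z : C) i j (f : Arc XD u0 z) (ci : Arc XD z z) :
  z = (RtoC p + v)%C ->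
  snd v < 0 ->
  (forall t, unit_I t -> snd (f t) < 0) ->
  (forall t, unit_I t -> ci t = (RtoC p + v * cis (2 * PI * t))%C) ->
  (i <= 4)%nat -> mark i < p + Cmod v < mark (S i) ->
  (j <= 4)%nat -> mark j < p - Cmod v < mark (S j) ->
  f ;; ci ;; ! f ~~ cross i ;; ! cross j.
Proof.
intros -> hv hf hci hi mi hj mj.
assert (hPI := PI_RGT_0).
assert (hmid : ci (1/2) = (RtoC p - v)%C).
{ rewrite hci by (split; lra); replace (2 * PI * (1/2)) with PI by field; rewrite cis_PI; ring. }
assert (hc0 : forall t, unit_I t -> disk_D (ci t)) by (intros t ht; exact (proj1 (fn_in ci t ht))).
assert (hd : disk_D (RtoC p - v)%C) by (rewrite <- hmid; apply hc0; split; lra).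
assert (hup : 0 < snd (RtoC p - v)%C) by (simpl; lra).
unshelve epose (h1 := mkArc (X := XD) (a := (RtoC p + v)%C) (b := (RtoC p - v)%C) (fun t => ci (t / 2)) _ _ _ _).
{ cont. }
{ intros t [? ?]; apply fn_in; split; lra. }
{ cbv beta; replace (0 / 2) with 0 by lra; apply fn_0. }
{ exact hmid. }
unshelve epose (h2 := mkArc (X := XD) (a := (RtoC p - v)%C) (b := (RtoC p + v)%C) (fun t => ci ((1 + t) / 2)) _ _ _ _).
{ cont. }
{ intros t [? ?]; apply fn_in; split; lra. }
{ cbv beta; replace ((1 + 0) / 2) with (1 / 2) by lra; exact hmid. }
{ cbv beta; replace ((1 + 1) / 2) with 1 by lra; apply fn_1. }
assert (eci : ci ~~ h1 ;; h2).
{ apply hom_ext; intros t _; simpl; unfold concat; destruct (Rle_dec _ _); f_equal; lra. }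
assert (hX : forall t, unit_I t -> XD (segment (RtoC p - v)%C top t)).
{ intros t ht; destruct (segment_up _ hd hup t ht); apply off_axis_XD; trivial; lra. }
set (up := aseg hX).
assert (aup : forall k, along (slitk k) up).
{ intros k t ht; destruct (segment_up _ hd hup t ht); apply off_axis_slit; trivial.
  change (snd (segment (RtoC p - v)%C top t) <> 0); lra. }
assert (af : forall k, along (slitk k) f).
{ intros k t ht; apply off_axis_slit; [exact (proj1 (fn_in f t ht)) | generalize (hf t ht); lra]. }
assert (e1 : f ;; h1 ;; up ~~ cross i).
{ apply (hom_star (slitk i) (gate i)); [now apply slitk_star | | now apply cross_along].
  apply along_cat; trivial; apply along_cat; trivial.
  intros t [? ?]; change (slitk i (ci (t / 2))); split; [apply hc0; split; lra|].
  rewrite hci by (split; lra); replace (2 * PI * (t / 2)) with (PI * t) by field.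
  destruct (Req_dec (snd (v * cis (PI * t))%C) 0) as [e | n].
  - right; change (mark i < p + fst (v * cis (PI * t))%C < mark (S i)).
    rewrite half_circle; trivial; nra.
  - left; change (0 + snd (v * cis (PI * t))%C <> 0); lra. }
assert (e2 : f ;; ! h2 ;; up ~~ cross j).
{ apply (hom_star (slitk j) (gate j)); [now apply slitk_star | | now apply cross_along].
  apply along_cat; trivial; apply along_cat; trivial; apply along_inv.
  intros t [? ?]; change (slitk j (ci ((1 + t) / 2))); split; [apply hc0; split; lra|].
  rewrite hci by (split; lra); replace (2 * PI * ((1 + t) / 2)) with (PI + PI * t) by field.
  rewrite <- cis_plus, cis_PI.
  replace (v * (-1 * cis (PI * t)))%C with (- (v * cis (PI * t)))%C by ring.
  destruct (Req_dec (snd (v * cis (PI * t))%C) 0) as [e | n].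
  - right; change (mark j < p + - fst (v * cis (PI * t))%C < mark (S j)).
    rewrite half_circle; trivial; nra.
  - left; change (0 + - snd (v * cis (PI * t))%C <> 0); lra. }
rewrite <- e1, <- e2, eci.
rewrite !ainv_cat, ainv_inv, !acat_assoc, acat_invK; reflexivity.
Qed.

(** [rot (2 PI s (alpha - 1))] fixes the punctures in the disk for every [s] and deforms the identity
    into [rot (2 PI alpha)], while the base point runs clockwise around the circle through it. *)
Lemma twist_conj (alpha : R -> R) (v : C)
  (hc : contC (rot (fun r => 2 * PI * alpha r)))
  (hX : forall y, XD y -> XD (rot (fun r => 2 * PI * alpha r) y))
  (hv : rot (fun r => 2 * PI * alpha r) v = v)
  (ci g : Arc XD v v) :
  @contR R_UniformSpace alpha -> alpha (Cmod v) = 0 ->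
  (forall y, puncture y -> Cmod y <= Cmod v -> alpha (Cmod y) = 1) ->
  (forall t, unit_I t -> ci t = (v * cis (2 * PI * t))%C) ->
  (forall t, unit_I t -> Cmod (g t) <= Cmod v) ->
  amap _ hc hX hv hv g ~~ ci ;; g ;; ! ci.
Proof.
intros ca a0 a1 hci hg.
(* Here [s] runs from the twist, whose angle is changed by a full turn, to the identity. Modulo full
   turns the base point has angle [2 * PI * s], so both of its tracks are [ci]. A stage landing on a
   puncture would be a full rest there, since [alpha] is 1 at that modulus. *)
set (F := fun s t => rot (fun r => 2 * PI * (1 - s) * (alpha r - 1)) (g t)).
assert (e : amap _ hc hX hv hv g ;; ci ~~ ci ;; g).
{ apply (hom_free F).
  - unfold F, rot; unfold contC2; cont.
  - intros s t hs ht; split.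
    + unfold disk_D, F; rewrite Cmod_rot; exact (proj1 (fn_in g t ht)).
    + intro hp; assert (h1 : alpha (Cmod (g t)) = 1).
      { rewrite <- (Cmod_rot (fun r => 2 * PI * (1 - s) * (alpha r - 1)) (g t)).
        apply a1; trivial; unfold F in *; rewrite Cmod_rot; auto. }
      unfold F in hp; rewrite rot_fix in hp; [exact (proj2 (fn_in g t ht) hp)|].
      rewrite h1, Rminus_diag, Rmult_0_r; apply cis_0.
  - intros t ht; change (F 0 t = rot (fun r => 2 * PI * alpha r) (g t)); unfold F, rot.
    replace (2 * PI * alpha (Cmod (g t)))
      with (2 * PI * (1 - 0) * (alpha (Cmod (g t)) - 1) + 2 * PI) by ring.
    rewrite <- cis_plus, cis_2PI; ring.
  - intros t ht; apply rot_fix; rewrite Rminus_diag, Rmult_0_r, Rmult_0_l; apply cis_0.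
  - intros s hs; unfold F, rot; rewrite fn_0, hci, a0 by trivial.
    replace (2 * PI * s) with (2 * PI * (1 - s) * (0 - 1) + 2 * PI) by ring.
    rewrite <- cis_plus, cis_2PI; ring.
  - intros s hs; unfold F, rot; rewrite fn_1, hci, a0 by trivial.
    replace (2 * PI * s) with (2 * PI * (1 - s) * (0 - 1) + 2 * PI) by ring.
    rewrite <- cis_plus, cis_2PI; ring. }
rewrite <- (aone_r (fn_end ci) (amap _ hc hX hv hv g)), <- (ainv_r (fn_end ci) ci), <- acat_assoc, e.
apply acat_assoc.
Qed.

(** * The generators and the action of the twist *)

Definition circle (p : R) (v : C) : path := fun t => (RtoC p + v * cis (2 * PI * t))%C.

Lemma circle_cont p v : @contC R_UniformSpace (circle p v).
Proof. unfold circle; cont. Qed.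

Lemma circle_0 p v : circle p v 0 = (RtoC p + v)%C.
Proof. unfold circle; rewrite Rmult_0_r, cis_0; ring. Qed.

Lemma circle_1 p v : circle p v 1 = (RtoC p + v)%C.
Proof. unfold circle; rewrite Rmult_1_r, cis_2PI; ring. Qed.

(** Punctures are at least 1 apart and of modulus at most 2, so a circle of positive radius below 1
    about one of them misses all of them and stays in the disk. *)
Lemma circle_XD j v t : (j <= 3)%nat -> 0 < Cmod v < 1 -> XD (circle (mark (S j)) v t).
Proof.
intros hj hv.
assert (hw : Cmod (v * cis (2 * PI * t))%C = Cmod v) by (rewrite Cmod_mult, Cmod_cis; ring).
unfold circle; set (w := (v * cis (2 * PI * t))%C) in *; clearbody w.
assert (hm' : mark (S j) = -2 \/ mark (S j) = -1 \/ mark (S j) = 1 \/ mark (S j) = 2)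
  by (cases5 j; try lra; lia).
generalize dependent (mark (S j)); intros p hm'.
assert (hm : Rabs p <= 2) by (apply Rabs_le; lra).
split.
- unfold disk_D; eapply Rle_trans; [apply Cmod_triangle|]; rewrite Cmod_R; lra.
- intros [h0 h1]; simpl in h0, h1.
  assert (q : fst w ^ 2 = Cmod v ^ 2) by (rewrite <- hw, Cmod_sqr; replace (snd w) with 0 by lra; ring).
  assert (n : fst w <> 0) by (intro e; rewrite e in q; nra).
  assert (q1 : fst w ^ 2 < 1) by nra.
  assert (b : -1 < fst w < 1) by (split; nra).
  destruct (Rlt_dec (fst w) 0), hm' as [? | [? | [? | ?]]], h1 as [? | [? | [? | ?]]]; lra.
Qed.

Lemma direction_low p : snd (direction p) < 0.
Proof.
unfold direction; set (r := Cmod _).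
assert (h : 0 < r).
{ apply Cmod_gt_0; intro e; apply (f_equal snd) in e; simpl in e; lra. }
replace (snd _) with (-4 / r).
- apply Ropp_lt_cancel; rewrite Ropp_0; unfold Rdiv.
  rewrite <- Ropp_mult_distr_l_reverse; apply Rmult_lt_0_compat; [lra | now apply Rinv_0_lt_compat].
- simpl; field; lra.
Qed.

Lemma Cmod_direction p : Cmod (direction p) = 1.
Proof.
unfold direction; set (z := (u0 - RtoC p)%C).
assert (h : 0 < Cmod z).
{ apply Cmod_gt_0; intro e; apply (f_equal snd) in e; simpl in e; lra. }
rewrite Cmod_div, Cmod_R, Rabs_pos_eq by (try (intro e; apply RtoC_inj in e); lra).
field; lra.
Qed.

Lemma segment_low y z t : snd y < 0 -> snd z < 0 -> unit_I t -> snd (segment y z t) < 0.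
Proof. intros hy hz [? ?]; unfold segment; simpl; nra. Qed.

Lemma segment_low_XD y z : disk_D y -> disk_D z -> snd y < 0 -> snd z < 0 ->
  forall t, unit_I t -> XD (segment y z t).
Proof.
intros dy dz hy hz t ht; apply off_axis_XD; [now apply disk_segment|].
generalize (segment_low y z t hy hz ht); lra.
Qed.

Lemma u0_low : snd u0 < 0. Proof. simpl; lra. Qed.

Lemma mark_between j e : (j <= 3)%nat -> 0 < e < 1 ->
  mark (S j) < mark (S j) + e < mark (S (S j)) /\ mark j < mark (S j) - e < mark (S j).
Proof. intros hj he; cases5 j; try lra; lia. Qed.

(** The index is shifted: [j] starts at 0, and the generator around puncture [S j] rises through gap
    [S j] and falls through gap [j]. *)
Lemma g_loop_arc j eps : (j <= 3)%nat -> 0 < eps < 1 ->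
  exists x : Arc XD u0 u0, fn x = g_loop eps (mark (S j)) /\ x ~~ cross (S j) ;; ! cross j.
Proof.
intros hj he; set (p := mark (S j)).
set (v := (RtoC eps * direction p)%C).
assert (mv : Cmod v = eps).
{ unfold v; rewrite Cmod_mult, Cmod_direction, Cmod_R, Rabs_pos_eq by lra; ring. }
assert (lv : snd v < 0).
{ generalize (direction_low p); unfold v; set (d := direction p); simpl; nra. }
assert (hX : forall t, XD (circle p v t)) by (intro; apply circle_XD; trivial; lra).
assert (hz : disk_D (RtoC p + v)%C) by (rewrite <- circle_0; apply hX).
assert (lz : snd (RtoC p + v)%C < 0) by (change (0 + snd v < 0); lra).
set (f := aseg (segment_low_XD _ _ u0_disk hz u0_low lz)).
set (ci := mkArc (X := XD) (circle p v) (circle_cont p v) (fun t _ => hX t) (circle_0 p v) (circle_1 p v)).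
exists (f ;; ci ;; ! f); split; [reflexivity|].
destruct (mark_between j eps hj he).
apply (circle_split p v); trivial; try lia; rewrite ?mv; trivial.
intros t ht; apply segment_low; trivial; apply u0_low.
Qed.

(** The twist [y |-> y cis (2 PI (outer |y| + inner |y|))] turns the punctures at radius [1] twice
    and those at radius [2] once. *)
Definition outer (r : R) : R := Rmin 1 (2 - r / 2).
Definition inner (r : R) : R := Rmax 0 (Rmin 1 (5 - 4 * r)).

Lemma contR_outer : @contR R_UniformSpace outer.
Proof. unfold outer; cont. Qed.

Lemma contR_inner : @contR R_UniformSpace inner.
Proof. unfold inner; cont. Qed.

Lemma contC_rot phi : @contR R_UniformSpace phi -> contC (rot phi).
Proof. intro h; unfold rot; cont. Qed.

Lemma puncture_Cmod y : puncture y -> Cmod y = 1 \/ Cmod y = 2.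
Proof.
intros [h0 h]; destruct h as [h | [h | [h | h]]];
  [right | left | left | right]; apply Cmod_eq; try lra; rewrite h, h0; ring.
Qed.

Lemma outer_2 r : r <= 2 -> outer r = 1.
Proof. intro; unfold outer; rewrite Rmin_left; lra. Qed.

Lemma outer_4 : outer 4 = 0.
Proof. unfold outer; rewrite Rmin_right; lra. Qed.

Lemma inner_1 r : r <= 1 -> inner r = 1.
Proof. intro; unfold inner; rewrite Rmin_left, Rmax_right; lra. Qed.

Lemma inner_54 r : 5 / 4 <= r -> inner r = 0.
Proof. intro; unfold inner; rewrite Rmin_right, Rmax_left; lra. Qed.

Definition rotO := rot (fun r => 2 * PI * outer r).
Definition rotI := rot (fun r => 2 * PI * inner r).

Lemma rotO_cont : contC rotO.
Proof. apply contC_rot; generalize contR_outer; intro; cont. Qed.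

Lemma rotI_cont : contC rotI.
Proof. apply contC_rot; generalize contR_inner; intro; cont. Qed.

(** [rot phi] preserves the modulus, hence the angle it turns by, and is therefore injective. If
    [rot phi y] were a puncture, it would be fixed, and cancelling the rotation would make [y] that
    puncture. *)
Lemma rot_XD phi : (forall y, puncture y -> rot phi y = y) -> forall y, XD y -> XD (rot phi y).
Proof.
intros h y [hd hp]; split; [unfold disk_D; now rewrite Cmod_rot|].
intro h'; assert (e := h _ h'); revert h'; unfold rot in e at 1.
rewrite Cmod_rot in e; fold (rot phi y) in e.
assert (e' : (rot phi y * cis (phi (Cmod y)) = y * cis (phi (Cmod y)))%C) by exact e.
replace (rot phi y) with y; [exact hp|].
symmetry; replace (rot phi y) with (rot phi y * cis (phi (Cmod y)) * cis (- phi (Cmod y)))%C.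
- rewrite e', <- Cmult_assoc, cis_plus, Rplus_opp_r, cis_0; ring.
- rewrite <- Cmult_assoc, cis_plus, Rplus_opp_r, cis_0; ring.
Qed.

Lemma rotO_puncture y : puncture y -> rotO y = y.
Proof.
intro h; apply rot_fix; rewrite outer_2, Rmult_1_r; [apply cis_2PI|].
destruct (puncture_Cmod y h); lra.
Qed.

Lemma rotI_far y : 5 / 4 <= Cmod y -> rotI y = y.
Proof. intro h; apply rot_fix; rewrite inner_54, Rmult_0_r; [apply cis_0 | exact h]. Qed.

Lemma rotI_puncture y : puncture y -> rotI y = y.
Proof.
intro h; destruct (puncture_Cmod y h); [|apply rotI_far; lra].
apply rot_fix; rewrite inner_1, Rmult_1_r; [apply cis_2PI | lra].
Qed.

Lemma Cmod_u0 : Cmod u0 = 4.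
Proof. apply Cmod_eq; simpl; lra. Qed.

Lemma rotO_u0 : rotO u0 = u0.
Proof. apply rot_fix; rewrite Cmod_u0, outer_4, Rmult_0_r; apply cis_0. Qed.

Lemma rotI_u0 : rotI u0 = u0.
Proof. apply rotI_far; rewrite Cmod_u0; lra. Qed.

Definition twistO : Arc XD u0 u0 -> Arc XD u0 u0 :=
  amap rotO rotO_cont (rot_XD _ rotO_puncture) rotO_u0 rotO_u0.
Definition twistI : Arc XD u0 u0 -> Arc XD u0 u0 :=
  amap rotI rotI_cont (rot_XD _ rotI_puncture) rotI_u0 rotI_u0.

Lemma big_circle_XD t : unit_I t -> XD (circle 0 u0 t).
Proof.
intros ht; assert (h : Cmod (circle 0 u0 t) = 4).
{ unfold circle; rewrite Cplus_0_l, Cmod_mult, Cmod_u0, Cmod_cis; ring. }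
split; [unfold disk_D; lra|].
intro hp; destruct (puncture_Cmod _ hp); lra.
Qed.

(** The boundary circle starts at [u0], so [circle_split] with a constant tail identifies it with
    the crossing word; [twist_conj] then applies to the whole disk. *)
Lemma twistO_conj x : twistO x ~~ (cross 4 ;; ! cross 0) ;; x ;; ! (cross 4 ;; ! cross 0).
Proof.
set (ci := mkArc (X := XD) (circle 0 u0) (circle_cont 0 u0) big_circle_XD
   (eq_trans (circle_0 0 u0) (Cplus_0_l u0)) (eq_trans (circle_1 0 u0) (Cplus_0_l u0))).
assert (xu : XD u0) by (rewrite <- (fn_0 x); now apply fn_in).
assert (e : ci ~~ cross 4 ;; ! cross 0).
{ rewrite <- (circle_split 0 u0 u0 4 0 (aone xu) ci); trivial; try lia.
  - rewrite aone_l, <- (aone_r xu ci) at 1.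
    apply hom_acat; [reflexivity|]; now apply hom_ext.
  - now rewrite Cplus_0_l.
  - simpl; lra.
  - intros; simpl; lra.
  - rewrite Cmod_u0; simpl; lra.
  - rewrite Cmod_u0; simpl; lra. }
rewrite <- e; apply twist_conj.
- apply contR_outer.
- rewrite Cmod_u0; apply outer_4.
- intros y hy _; apply outer_2; destruct (puncture_Cmod y hy); lra.
- intros; simpl; unfold circle; ring.
- intros t ht; rewrite Cmod_u0; exact (proj1 (fn_in x t ht)).
Qed.

Lemma segment_far k y t : (k <= 4)%nat -> k <> 2%nat -> fst y = 0 -> snd y ^ 2 = 16 ->
  5 / 4 <= Cmod (segment y (gate k) t).
Proof.
intros hk h2 y1 y2; apply Rsqr_incr_0; [|lra|apply Cmod_ge_0].
rewrite !Rsqr_pow2, Cmod_sqr; unfold segment; simpl fst; simpl snd; rewrite y1.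
assert (g : 9/4 <= gate k ^ 2) by (cases5 k; try lra; lia).
match goal with |- _ <= ?e =>
  replace e with (t ^ 2 * gate k ^ 2 + (1 - t) ^ 2 * snd y ^ 2) by ring end.
rewrite y2; assert (0 <= t ^ 2 * (gate k ^ 2 - 9/4)) by (apply Rmult_le_pos; [apply pow2_ge_0 | lra]).
(* With 9/4 in place of the squared gate, the squared modulus is least at [t = 64/73], where it is
   144/73, more than 25/16. *)
generalize (pow2_ge_0 (73 * t - 64)); nra.
Qed.

Lemma cross_far k : (k <= 4)%nat -> k <> 2%nat -> along (fun y => rotI y = y) (cross k).
Proof.
intros hk h2; assert (e : min k 4 = k) by lia.
apply along_cat; [|apply along_inv]; intros t ht; apply rotI_far; simpl fn; rewrite e;
  apply segment_far; trivial; simpl; ring.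
Qed.

(** The loops around the outer punctures do not use the middle gap, and arcs through the other gaps
    stay where [rotI] is the identity. *)
Lemma twistI_fix j x : (j = 0 \/ j = 3)%nat -> x ~~ cross (S j) ;; ! cross j -> twistI x ~~ x.
Proof.
intros hj e; unfold twistI; rewrite e.
apply amap_along, along_cat; [|apply along_inv]; apply cross_far; lia.
Qed.

Definition low54 : C := (0, -5/4).

Lemma Cmod_low54 : Cmod low54 = 5/4.
Proof. apply Cmod_eq; simpl; lra. Qed.

Lemma small_circle_XD t : unit_I t -> XD (circle 0 low54 t).
Proof.
intros ht; assert (h : Cmod (circle 0 low54 t) = 5/4).
{ unfold circle; rewrite Cplus_0_l, Cmod_mult, Cmod_low54, Cmod_cis; ring. }
split; [unfold disk_D; lra|].
intro hp; destruct (puncture_Cmod _ hp); lra.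
Qed.

(** The base point is moved to [low54], on the circle where [inner] becomes 0, and [x] is redrawn
    inside that circle. There [twist_conj] gives conjugation by the circle; the tail [s] back to
    [u0] is fixed by [rotI]. *)
Lemma twistI_conj j x : (j = 1 \/ j = 2)%nat -> x ~~ cross (S j) ;; ! cross j ->
  twistI x ~~ (cross 3 ;; ! cross 1) ;; x ;; ! (cross 3 ;; ! cross 1).
Proof.
intros hj ex.
assert (hm : mark (S j) = -1 \/ mark (S j) = 1) by (destruct hj as [-> | ->]; simpl; lra).
(* The radius 1/8 keeps the circle about [p], of modulus 1, inside the disk of radius 5/4. *)
set (p := mark (S j)) in *; set (v := (0, -1/8) : C).
assert (mv : Cmod v = 1/8) by (apply Cmod_eq; simpl; lra).
assert (hX : forall t, XD (circle p v t)) by (intro; apply circle_XD; [lia | lra]).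
assert (hz : disk_D (RtoC p + v)%C) by (rewrite <- circle_0; apply hX).
assert (lz : snd (RtoC p + v)%C < 0) by (simpl; lra).
assert (hl : disk_D low54) by (unfold disk_D; rewrite Cmod_low54; lra).
assert (ll : snd low54 < 0) by (simpl; lra).
set (s := aseg (segment_low_XD _ _ u0_disk hl u0_low ll)).
set (f := aseg (segment_low_XD _ _ hl hz ll lz)).
set (ci := mkArc (X := XD) (circle p v) (circle_cont p v) (fun t _ => hX t) (circle_0 p v) (circle_1 p v)).
set (k := mkArc (X := XD) (circle 0 low54) (circle_cont 0 low54) small_circle_XD
   (eq_trans (circle_0 0 low54) (Cplus_0_l low54)) (eq_trans (circle_1 0 low54) (Cplus_0_l low54))).
(* The circle of radius 5/4 meets the axis at 5/4 and -5/4, in gaps 3 and 1. *)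
assert (ek : s ;; k ;; ! s ~~ cross 3 ;; ! cross 1).
{ apply (circle_split 0 low54); trivial; try lia.
  - now rewrite Cplus_0_l.
  - intros t ht; apply segment_low; trivial; apply u0_low.
  - rewrite Cmod_low54; simpl; lra.
  - rewrite Cmod_low54; simpl; lra. }
assert (ey : s ;; (f ;; ci ;; ! f) ;; ! s ~~ x).
{ assert (mb := mark_between j (1/8)); destruct mb as [m1 m2]; [lia | lra |].
  rewrite ex, <- (circle_split p v _ (S j) j (s ;; f) ci); trivial; try lia.
  - rewrite ainv_cat, !acat_assoc; reflexivity.
  - simpl; lra.
  - intros t ht; apply (along_cat (fun y => snd y < 0) s f); trivial; intros r hr;
      apply segment_low; trivial; apply u0_low.
  - rewrite mv; exact m1.
  - rewrite mv; exact m2. }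
assert (ri : rotI low54 = low54) by (apply rotI_far; rewrite Cmod_low54; lra).
assert (es : amap rotI rotI_cont (rot_XD _ rotI_puncture) rotI_u0 ri s ~~ s).
{ apply amap_along; intros t [t0 t1]; apply rotI_far.
  apply Rsqr_incr_0; [|lra|apply Cmod_ge_0].
  change (s t) with (segment u0 low54 t).
  rewrite !Rsqr_pow2, Cmod_sqr; unfold segment; simpl; nra. }
assert (et : amap rotI rotI_cont (rot_XD _ rotI_puncture) ri ri (f ;; ci ;; ! f)
   ~~ k ;; (f ;; ci ;; ! f) ;; ! k).
{ apply twist_conj.
  - apply contR_inner.
  - rewrite Cmod_low54; apply inner_54; lra.
  - intros y hy; rewrite Cmod_low54; intro; apply inner_1; destruct (puncture_Cmod y hy); lra.
  - intros; simpl; unfold circle; ring.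
  - rewrite Cmod_low54.
    assert (hf : along (fun y => Cmod y <= 5/4) f).
    { intros t [t0 t1]; apply Cmod_le; [lra|].
      change (f t) with (segment low54 (RtoC p + v)%C t); unfold segment; simpl.
      destruct hm as [hm | hm]; rewrite hm; nra. }
    apply (along_cat (fun y => Cmod y <= 5/4)); trivial.
    apply (along_cat (fun y => Cmod y <= 5/4)); [|now apply along_inv].
    intros t ht; change (ci t) with (circle p v t); unfold circle.
    eapply Rle_trans; [apply Cmod_triangle|].
    rewrite Cmod_mult, Cmod_cis, mv, Cmod_R; destruct hm as [hm | hm]; rewrite hm;
      [rewrite Rabs_left by lra | rewrite Rabs_pos_eq by lra]; lra. }
unfold twistI; rewrite <- ey, <- ek.
rewrite (amap_cat rotI _ _ _ ri), (amap_cat rotI _ _ _ ri), amap_inv, es, et.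
rewrite !ainv_cat, !ainv_inv, !acat_assoc, !ainv_catK; reflexivity.
Qed.

(** * A smooth realization *)

(** This class of functions is closed under partial derivatives, so its members are of class C^k
    for every k. *)
Inductive sexp : Type :=
| Fst | Snd | Cst (c : R) | Add (e f : sexp) | Mul (e f : sexp) | Cos (e : sexp) | Sin (e : sexp).

Fixpoint eval (e : sexp) (z : C) : R :=
  match e with
  | Fst => fst z
  | Snd => snd z
  | Cst c => c
  | Add e f => eval e z + eval f z
  | Mul e f => eval e z * eval f z
  | Cos e => cos (eval e z)
  | Sin e => sin (eval e z)
  end.

(** The formal derivative in the direction [(dfst, dsnd)]; the directions (1, 0) and (0, 1) give the
    partial derivatives. *)
Fixpoint deriv (dfst dsnd : R) (e : sexp) : sexp :=
  match e with
  | Fst => Cst dfst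
  | Snd => Cst dsnd
  | Cst _ => Cst 0
  | Add e f => Add (deriv dfst dsnd e) (deriv dfst dsnd f)
  | Mul e f => Add (Mul (deriv dfst dsnd e) f) (Mul e (deriv dfst dsnd f))
  | Cos e => Mul (Mul (Cst (-1)) (Sin e)) (deriv dfst dsnd e)
  | Sin e => Mul (Cos e) (deriv dfst dsnd e)
  end.

Lemma eval_cont e : @contR C_UniformSpace (eval e).
Proof.
induction e; simpl.
- apply (contR_fst (fun z => z)), contC_id.
- apply (contR_snd (fun z => z)), contC_id.
- apply contR_const.
- now apply contR_plus.
- now apply contR_mult.
- apply (contR_comp cos); [intro; apply continuous_cos | assumption].
- apply (contR_comp sin); [intro; apply continuous_sin | assumption].
Qed.

Lemma eval_deriv e (l : R -> C) (d1 d2 a : R) :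
  is_derive (fun s => fst (l s)) a d1 -> is_derive (fun s => snd (l s)) a d2 ->
  is_derive (fun s => eval e (l s)) a (eval (deriv d1 d2 e) (l a)).
Proof.
intros h1 h2; induction e; simpl; trivial.
- apply (is_derive_const (V := R_NormedModule)).
- now apply (is_derive_plus (V := R_NormedModule)).
- apply is_derive_Reals; apply (derivable_pt_lim_mult (fun s => eval e1 (l s)) (fun s => eval e2 (l s)));
    now apply is_derive_Reals.
- apply is_derive_Reals.
  replace (-1 * sin (eval e (l a))) with (- sin (eval e (l a))) by ring.
  apply (derivable_pt_lim_comp (fun s => eval e (l s)) cos);
    [now apply is_derive_Reals | apply derivable_pt_lim_cos].
- apply is_derive_Reals.
  apply (derivable_pt_lim_comp (fun s => eval e (l s)) sin);
    [now apply is_derive_Reals | apply derivable_pt_lim_sin].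
Qed.

Lemma eval_Ck k e U : Ck k U (eval e).
Proof.
revert e; induction k as [|k IH]; intro e; (split; [intros z _; apply eval_cont|]); trivial.
exists (eval (deriv 1 0 e)), (eval (deriv 0 1 e)); split; [|split; apply IH].
intros a b _; split.
- exact (eval_deriv e (fun s => (s, b)) 1 0 a (is_derive_id (K := R_AbsRing) a)
           (is_derive_const (K := R_AbsRing) (V := R_NormedModule) b a)).
- exact (eval_deriv e (fun s => (a, s)) 0 1 b (is_derive_const (K := R_AbsRing) (V := R_NormedModule) a b)
           (is_derive_id (K := R_AbsRing) b)).
Qed.

Lemma eval_smooth_on_D e1 e2 (f : C -> C) :
  (forall y, f y = (eval e1 y, eval e2 y)) -> smooth_on_D f.
Proof.
intro h; exists (fun _ => True), (fun y => (eval e1 y, eval e2 y)).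
split; [apply open_true | split; [trivial | split; [now intros|]]].
intro k; split; apply (eval_Ck k).
Qed.

(** The quadratic polynomial with values [2, 1, 0] at [1, 4, 16], the squared moduli of the inner
    and outer punctures and of the boundary. *)
Definition turns (q : R) : R := 2 - (q - 1) / 3 + (q - 1) * (q - 4) / 60.

(** The angle is a polynomial in the squared modulus, so the map is smooth also at the origin,
    whereas [outer] and [inner] have corners. *)
Definition spin (t : R) : C -> C := rot (fun r => 2 * PI * t * turns (r ^ 2)).

Lemma spin_smooth t : smooth_on_D (spin t).
Proof.
set (q := Add (Mul Fst Fst) (Mul Snd Snd)).
set (w := Mul (Cst (2 * PI * t))
  (Add (Add (Cst 2) (Mul (Cst (-1/3)) (Add q (Cst (-1)))))
       (Mul (Cst (1/60)) (Mul (Add q (Cst (-1))) (Add q (Cst (-4))))))).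
apply (eval_smooth_on_D
  (Add (Mul Fst (Cos w)) (Mul (Cst (-1)) (Mul Snd (Sin w))))
  (Add (Mul Fst (Sin w)) (Mul Snd (Cos w)))).
intros y; unfold spin, rot; rewrite Cmod_sqr.
replace (2 * PI * t * turns (fst y ^ 2 + snd y ^ 2)) with (eval w y)
  by (unfold turns; simpl; field).
unfold Cmult, cis; simpl fst; simpl snd; f_equal; simpl; ring.
Qed.

Lemma spin_disk t y : disk_D y -> disk_D (spin t y).
Proof. unfold disk_D, spin; now rewrite Cmod_rot. Qed.

Lemma spin_spin s t y : spin s (spin t y) = spin (s + t) y.
Proof. unfold spin; rewrite rot_rot; unfold rot; do 2 f_equal; ring. Qed.

Lemma spin_0 y : spin 0 y = y.
Proof. apply rot_fix; rewrite Rmult_0_r, Rmult_0_l; apply cis_0. Qed.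

Lemma spinK t y : spin (- t) (spin t y) = y.
Proof. rewrite spin_spin, Rplus_opp_l; apply spin_0. Qed.

Lemma spin_diffeo t : diffeo_D (spin t).
Proof.
split; [apply spin_smooth | split; [intro; apply spin_disk|]].
exists (spin (- t)); split; [apply spin_smooth | split; [intro; apply spin_disk|]].
split; intros y _; [apply spinK|].
rewrite <- (Ropp_involutive t) at 1; apply spinK.
Qed.

Lemma spin_boundary t y : boundary_D y -> spin t y = y.
Proof.
intro h; apply rot_fix; rewrite h; replace (2 * PI * t * turns (4 ^ 2)) with 0 by (unfold turns; field).
apply cis_0.
Qed.

Lemma spin_2 t y : Cmod y = 2 -> spin t y = (y * cis (2 * PI * t))%C.
Proof. intro h; unfold spin, rot; rewrite h; do 2 f_equal; unfold turns; field. Qed.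

Lemma spin_1 t y : Cmod y = 1 -> spin t y = (y * (cis (2 * PI * t) * cis (2 * PI * t)))%C.
Proof. intro h; unfold spin, rot; rewrite h, cis_plus; do 2 f_equal; unfold turns; field. Qed.

Lemma cis_opp_2PI : cis (- (2 * PI)) = 1.
Proof.
replace (cis (- (2 * PI))) with (cis (- (2 * PI)) * cis (2 * PI))%C by (rewrite cis_2PI; ring).
rewrite cis_plus, Rplus_opp_l; apply cis_0.
Qed.

Lemma spin_puncture t y : cis (2 * PI * t) = 1 -> puncture y -> spin t y = y.
Proof.
intros e h; destruct (puncture_Cmod y h) as [h1 | h2];
  [rewrite spin_1 | rewrite spin_2]; rewrite ?e; trivial; ring.
Qed.

(** * The fibers of the curve over the unit circle and the motion they form *)

Lemma curve_S_iff x y : Cmod x = 1 ->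
  curve_S x y <-> y = (-2 * x)%C \/ y = (- (x * x))%C \/ y = (x * x)%C \/ y = (2 * x)%C.
Proof.
intro hx; split.
- intros (_ & _ & h).
  destruct (Ceq_dec y (-2 * x)%C) as [? | n1]; auto.
  destruct (Ceq_dec y (- (x * x))%C) as [? | n2]; auto.
  destruct (Ceq_dec y (x * x)%C) as [? | n3]; auto.
  destruct (Ceq_dec y (2 * x)%C) as [? | n4]; auto.
  exfalso; revert h; repeat apply Cmult_neq_0; intro e.
  + apply n1; replace y with ((2 * x + y) - 2 * x)%C by ring; rewrite e; ring.
  + apply n4; replace y with (2 * x - (2 * x - y))%C by ring; rewrite e; ring.
  + apply n2; replace y with ((y + x * x) - x * x)%C by ring; rewrite e; ring.
  + apply n3; replace y with ((y - x * x) + x * x)%C by ring; rewrite e; ring.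
- intro h; split; [unfold disk_E; lra | split].
  + unfold disk_D; destruct h as [-> | [-> | [-> | ->]]];
      rewrite ?Cmod_opp, Cmod_mult, hx, ?Cmod_R; try lra.
    * rewrite Rabs_left by lra; lra.
    * rewrite Rabs_pos_eq by lra; lra.
  + destruct h as [-> | [-> | [-> | ->]]]; ring.
Qed.

Lemma C_eq_real (y : C) (r : R) : y = RtoC r <-> snd y = 0 /\ fst y = r.
Proof.
split; [now intros ->|]; intros [h0 h1]; destruct y; simpl in *; subst; reflexivity.
Qed.

Lemma fiber_one_iff y : fiber_one curve_S y <-> puncture y.
Proof.
unfold fiber_one; rewrite curve_S_iff by apply Cmod_1.
replace (-2 * 1)%C with (RtoC (-2)) by (rewrite Cmult_1_r; reflexivity).
replace (2 * 1)%C with (RtoC 2) by ring.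
replace (1 * 1)%C with (RtoC 1) by ring.
replace (- (RtoC 1))%C with (RtoC (-1)) by (unfold RtoC, Copp; simpl; f_equal; ring).
rewrite !C_eq_real; unfold puncture; tauto.
Qed.

Lemma puncture_iff y : puncture y <-> exists i, idx 4 i /\ RtoC (mark i) = y.
Proof.
unfold puncture, idx; split.
- intros [h0 h]; destruct h as [h | [h | [h | h]]];
    [exists 1%nat | exists 2%nat | exists 3%nat | exists 4%nat]; (split; [lia|]);
    symmetry; now apply C_eq_real.
- intros (i & hi & <-); simpl; split; trivial.
  assert (h : (i = 1 \/ i = 2 \/ i = 3 \/ i = 4)%nat) by lia.
  destruct h as [-> | [-> | [-> | ->]]]; simpl; auto.
Qed.

Lemma cis_sq_opp x : (- (x * x) = -1 * (x * x))%C.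
Proof. ring. Qed.

(** Punctures of modulus 2 turn with [x] and those of modulus 1 with [x * x], which traces the four
    branches of the curve. *)
Lemma spin_mark t y : curve_S (cis (2 * PI * t)) y <-> exists i, idx 4 i /\ spin t (RtoC (mark i)) = y.
Proof.
rewrite curve_S_iff by apply Cmod_cis.
assert (m1 : spin t (RtoC (mark 1)) = (-2 * cis (2 * PI * t))%C).
{ rewrite spin_2; [reflexivity|]; simpl; rewrite Cmod_R, Rabs_left; lra. }
assert (m2 : spin t (RtoC (mark 2)) = (- (cis (2 * PI * t) * cis (2 * PI * t)))%C).
{ rewrite spin_1, cis_sq_opp; [reflexivity|]; simpl; rewrite Cmod_R, Rabs_left; lra. }
assert (m3 : spin t (RtoC (mark 3)) = (cis (2 * PI * t) * cis (2 * PI * t))%C).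
{ rewrite spin_1; [apply Cmult_1_l|]; simpl; rewrite Cmod_R, Rabs_pos_eq; lra. }
assert (m4 : spin t (RtoC (mark 4)) = (2 * cis (2 * PI * t))%C).
{ rewrite spin_2; [reflexivity|]; simpl; rewrite Cmod_R, Rabs_pos_eq; lra. }
rewrite <- m1, <- m2, <- m3, <- m4; unfold idx; split.
- intros [h | [h | [h | h]]]; symmetry in h;
    [exists 1%nat | exists 2%nat | exists 3%nat | exists 4%nat]; (split; [lia | exact h]).
- intros (i & hi & <-).
  assert (h : (i = 1 \/ i = 2 \/ i = 3 \/ i = 4)%nat) by lia.
  destruct h as [-> | [-> | [-> | ->]]]; tauto.
Qed.

Lemma mark_lt i j : idx 4 i -> idx 4 j -> (i < j)%nat -> mark i < mark j.
Proof.
unfold idx; intros hi hj h.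
assert (e : (i = 1 \/ i = 2 \/ i = 3)%nat) by lia.
assert (e' : (j = 2 \/ j = 3 \/ j = 4)%nat) by lia.
destruct e as [-> | [-> | ->]], e' as [-> | [-> | ->]]; simpl; try lra; lia.
Qed.

(** This keeps the statement about all representatives [beta] from being vacuous. The strands are
    the orbits of the punctures under [spin], and the braid is [spin 1]. *)
Lemma monodromy_exists : exists beta, local_braid_monodromy 4 curve_S beta.
Proof.
set (m := fun i t => spin t (RtoC (mark i))).
assert (hd : forall i, idx 4 i -> disk_D (RtoC (mark i))).
{ intros i hi; destruct (puncture_Cmod (RtoC (mark i))) as [e | e];
    [apply puncture_iff; eauto | |]; unfold disk_D; lra. }
assert (hm0 : forall i, m i 0 = RtoC (mark i)) by (intro; apply spin_0).
assert (hm1 : forall i, idx 4 i -> m i 1 = RtoC (mark i)).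
{ intros i hi; apply spin_puncture; [rewrite Rmult_1_r; apply cis_2PI|].
  apply puncture_iff; eauto. }
assert (hr : realizes 4 m spin).
{ split; [intros; apply spin_diffeo | split; [|split; [intros; apply spin_0 | split]]].
  - apply continuous_on_forall; intros q _.
    apply (contC_ext (fun q => snd q * cis (2 * PI * fst q * (2 - (Cmod (snd q) * Cmod (snd q) - 1) / 3
      + (Cmod (snd q) * Cmod (snd q) - 1) * (Cmod (snd q) * Cmod (snd q) - 4) / 60))))%C.
    + intros [s y]; unfold spin, rot, turns; simpl fst; simpl snd; do 2 f_equal; field.
    + cont.
  - intros; now apply spin_boundary.
  - intros i t hi ht; now rewrite hm0. }
exists (spin 1), m; split; [split|split].
- split; [|split; [|split; [|split]]].
  + intros i hi; apply continuous_on_forall; intros t _.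
    apply (contC_ext (fun t => RtoC (mark i) * cis (2 * PI * t * turns (Cmod (RtoC (mark i)) ^ 2))))%C;
      [reflexivity | cont].
  + intros i t hi ht; now apply spin_disk, hd.
  + intros i j t hi hj n ht e.
    (* Undoing the spin turns a collision of strands into an equality of marks. *)
    apply (f_equal (spin (- t))) in e; unfold m in e; rewrite !spinK in e.
    apply RtoC_inj in e.
    destruct (Nat.lt_total i j) as [h | [h | h]]; auto; apply mark_lt in h; trivial; lra.
  + intro y; rewrite fiber_one_iff, puncture_iff.
    split; intros (i & hi & <-); exists i; now rewrite hm0.
  + intro y; rewrite fiber_one_iff, puncture_iff.
    split; intros (i & hi & <-); exists i; now rewrite hm1.
- intros t y _; apply spin_mark.
- split; [apply spin_diffeo | split; [intros; now apply spin_boundary|]].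
  intros y _; rewrite !fiber_one_iff; split; intro h.
  + rewrite <- (spinK 1 y), spin_puncture; trivial.
    rewrite <- Ropp_mult_distr_r, Rmult_1_r; apply cis_opp_2PI.
  + rewrite spin_puncture; trivial; rewrite Rmult_1_r; apply cis_2PI.
- exists spin; split; [exact hr|].
  intros g (hc & hK & h0 & h1).
  assert (e0 := spin_boundary 1 u0 Cmod_u0).
  (* The stationary homotopy suffices; [g] is controlled only on the unit interval, so continuity is
     proved for its clamped extension. *)
  exists (fun _ t => spin 1 (g t)); split; [|split; [|split]].
  + assert (c : contC (fun t => spin 1 (g (clamp t)))).
    { apply (contC_comp (spin 1) (fun t => g (clamp t))).
      - unfold spin, turns; simpl; apply contC_rot; cont.
      - apply (contC_on_comp unit_I g clamp); auto.
        intro; apply (contR_clamp (fun t => t)); cont. }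
    apply (continuous_on_ext _ (fun q => spin 1 (g (clamp (snd q))))).
    * intros q [_ hq]; now rewrite clamp_id.
    * apply continuous_on_forall; intros q _.
      apply (contC_comp (fun t => spin 1 (g (clamp t))) snd); [exact c | apply contR_snd2].
  + intros s t _ ht; destruct (hK t ht) as [hd' hk]; split; [now apply spin_disk|].
    rewrite fiber_one_iff in *; intro hp; apply hk.
    rewrite <- (spinK 1 (g t)), spin_puncture; trivial.
    rewrite <- Ropp_mult_distr_r, Rmult_1_r; apply cis_opp_2PI.
  + intros s _; now rewrite h0, h1, e0.
  + now intros.
Qed.

(** * Relations and normal closures *)

Section Relators.
Context {X : C -> Prop} {a : C} (E : Arc X a a -> Arc X a a -> Prop).
Context {E_equiv : Equivalence E} {E_hom : subrelation hom E}.
Context {E_cat : Proper (E ==> E ==> E) (@acat X a a a)}.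
Context {E_inv : Proper (E ==> E) (@ainv X a a)}.

Definition commutes (f g : Arc X a a) : Prop := E (f ;; g) (g ;; f).

Lemma conj_commutes f g : E (f ;; g ;; ! f) g <-> commutes f g.
Proof.
unfold commutes; split; intro h.
- rewrite <- h at 2; rewrite !acat_assoc, (ainv_l (fn_start f)), aone_r; reflexivity.
- rewrite <- acat_assoc, h, acat_assoc, (ainv_r (fn_start f)), aone_r; reflexivity.
Qed.

Lemma commutes_cat f g h : commutes f g -> commutes f h -> commutes f (g ;; h).
Proof.
unfold commutes; intros h1 h2.
rewrite <- acat_assoc, h1, acat_assoc, h2, acat_assoc; reflexivity.
Qed.

Lemma commutes_inv f g : commutes f g -> commutes f (! g).
Proof.
unfold commutes; intro h.
transitivity (! g ;; (g ;; f) ;; ! g).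
- rewrite !acat_assoc, ainv_catK; reflexivity.
- rewrite <- h, !acat_assoc, (ainv_r (fn_start g)), aone_r; reflexivity.
Qed.

Lemma acat_cancel_l f g h : E (f ;; g) (f ;; h) -> E g h.
Proof. intro e; rewrite <- (ainv_catK f g), e, ainv_catK; reflexivity. Qed.

Lemma acat_cancel_r f g h : E (g ;; f) (h ;; f) -> E g h.
Proof.
intro e; rewrite <- (aone_r (fn_start f) g), <- (ainv_r (fn_start f) f), <- acat_assoc, e.
rewrite acat_assoc, (ainv_r (fn_start f)), aone_r; reflexivity.
Qed.

(** Cancelling a letter turns the first two equalities into commutation of [d] with [x1] and [x4],
    and the third into commutation of [d ;; e] with [x2]. As [e] is the product of the inverse of
    [x4], [d] and the inverse of [x1], it commutes with [d], hence with [d ;; e], and so does [x3],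
    which is [e] times the inverse of [x2]. *)
Lemma relations_iff x1 x2 x3 x4 :
  let d := x4 ;; x3 ;; x2 ;; x1 in
  let e := x3 ;; x2 in
  (E d (x1 ;; x4 ;; x3 ;; x2) /\
   E (x1 ;; x4 ;; x3 ;; x2) (x3 ;; x2 ;; x1 ;; x4) /\
   E (x4 ;; x3 ;; x2 ;; x1 ;; x3 ;; x2) (x2 ;; x4 ;; x3 ;; x2 ;; x1 ;; x3)) <->
  (commutes d x1 /\ commutes (d ;; e) x2 /\ commutes (d ;; e) x3 /\ commutes d x4).
Proof.
intros d e; split.
- intros (r1 & r2 & r3).
  assert (c1 : commutes d x1).
  { unfold commutes; rewrite r1 at 1; unfold d; rewrite !acat_assoc; reflexivity. }
  assert (c4 : commutes d x4).
  { unfold commutes; transitivity (x4 ;; x3 ;; x2 ;; x1 ;; x4).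
    - unfold d; rewrite !acat_assoc; reflexivity.
    - rewrite <- r2, <- r1; reflexivity. }
  assert (c2 : commutes (d ;; e) x2).
  { unfold commutes, d, e; rewrite !acat_assoc.
    transitivity ((x2 ;; x4 ;; x3 ;; x2 ;; x1 ;; x3) ;; x2).
    - rewrite <- r3, !acat_assoc; reflexivity.
    - rewrite !acat_assoc; reflexivity. }
  assert (cde : commutes d e).
  { assert (ee : E e (! x4 ;; d ;; ! x1)).
    { unfold d, e; rewrite !acat_assoc, (ainv_r (fn_start x1)), aone_r, ainv_catK; reflexivity. }
    unfold commutes; rewrite ee; apply commutes_cat; [now apply commutes_inv|].
    apply commutes_cat; [unfold commutes; reflexivity | now apply commutes_inv]. }
  repeat split; trivial.
  assert (e3 : E x3 (e ;; ! x2)) by (unfold e; rewrite acat_assoc, (ainv_r (fn_start x2)), aone_r; reflexivity).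
  unfold commutes; rewrite e3; apply commutes_cat; [|now apply commutes_inv].
  unfold commutes in *; rewrite cde at 1; rewrite !acat_assoc, cde; reflexivity.
- intros (c1 & c2 & c3 & c4); unfold commutes in c1, c2, c4.
  assert (r1 : E d (x1 ;; x4 ;; x3 ;; x2)).
  { apply (acat_cancel_r x1); rewrite c1; unfold d; rewrite !acat_assoc; reflexivity. }
  assert (r2 : E d (x3 ;; x2 ;; x1 ;; x4)).
  { apply (acat_cancel_l x4); rewrite <- c4; unfold d; rewrite !acat_assoc; reflexivity. }
  split; [exact r1 | split; [rewrite <- r1; exact r2|]].
  apply (acat_cancel_r x2); unfold d, e in c2; rewrite !acat_assoc in *; exact c2.
Qed.

End Relators.

(** * Passage between arcs and loops, and normal closures as congruences *)

#[local] Notation K1 := (fiber_one curve_S).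

Lemma XD_iff y : XD y <-> disk_D y /\ ~ K1 y.
Proof. unfold XD; now rewrite fiber_one_iff. Qed.

Lemma hom_homotopic (f g : Arc XD u0 u0) : f ~~ g -> homotopic K1 f g.
Proof.
intros (H & hc & hX & he & hfg); exists H; split; [|split; [|split]]; trivial.
- apply continuous_on_forall; intros q _; apply hc.
- intros; now apply XD_iff, hX.
Qed.

Lemma arc_is_loop (f : Arc XD u0 u0) : is_loop K1 f.
Proof.
split; [|split; [|split; [apply fn_0 | apply fn_1]]].
- apply continuous_on_forall; intros; apply fn_cont.
- intros t ht; now apply XD_iff, fn_in.
Qed.

Lemma homotopic_of_eq (f : Arc XD u0 u0) (g h : path) :
  (forall t, unit_I t -> g t = f t) -> (forall t, unit_I t -> h t = f t) -> homotopic K1 g h.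
Proof.
intros hg hh; exists (fun _ t => f t); split; [|split; [|split]].
- apply continuous_on_forall; intros q _.
  apply (contC_contR f (fun q => snd q) (fn_cont f) contR_snd2).
- intros; now apply XD_iff, fn_in.
- intros; now rewrite fn_0, fn_1.
- intros; now rewrite hg, hh.
Qed.

(** Clamping both parameters of the homotopy extends it to the plane; its two end stages are then
    arcs agreeing with the given paths on the unit interval. *)
Lemma homotopic_arcs g h : homotopic K1 g h ->
  exists f k : Arc XD u0 u0, f ~~ k /\
    (forall t, unit_I t -> f t = g t) /\ (forall t, unit_I t -> k t = h t).
Proof.
intros (H & hc & hX & he & hfg).
assert (c : contC2 (fun s t => H (clamp s) (clamp t))).
{ apply (contC_on_comp (fun q : R * R => unit_I (fst q) /\ unit_I (snd q))
    (fun q : R * R => H (fst q) (snd q)) (fun q : R * R => (clamp (fst q), clamp (snd q)))).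
  - exact hc.
  - intro q; apply (contC_pair (fun q : R * R => clamp (fst q)) (fun q : R * R => clamp (snd q))).
    + apply (contR_clamp (fun q => fst q) contR_fst2).
    + apply (contR_clamp (fun q => snd q) contR_snd2).
  - split; apply clamp_unit. }
assert (arc : forall s, unit_I s -> exists f : Arc XD u0 u0, forall t, f t = H s (clamp t)).
{ intros s hs; unshelve eexists (mkArc (fun t => H (clamp s) (clamp t)) _ _ _ _).
  - apply (contC_comp2 _ (fun _ => s) (fun t => t) c); cont.
  - intros; apply XD_iff, hX; apply clamp_unit.
  - cbv beta; rewrite (clamp_id 0) by trivial; apply he, clamp_unit.
  - cbv beta; rewrite (clamp_id 1) by trivial; apply he, clamp_unit.
  - intro t; simpl; now rewrite (clamp_id s). }
destruct (arc 0 unit_0) as [f hf], (arc 1 unit_1) as [k hk].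
exists f, k; split; [|split].
- exists (fun s t => H (clamp s) (clamp t)); split; [exact c | split; [|split]].
  + intros; apply XD_iff, hX; apply clamp_unit.
  + intros s _; rewrite (clamp_id 0), (clamp_id 1) by trivial; apply he, clamp_unit.
  + intros t _; rewrite (clamp_id 0), (clamp_id 1), hf, hk by trivial; auto.
- intros t ht; rewrite hf, clamp_id by trivial; now apply hfg.
- intros t ht; rewrite hk, clamp_id by trivial; now apply hfg.
Qed.

(** Equality in the quotient of the fundamental group by the normal closure of [Rel]. *)
Definition modulo (Rel : relations) (f g : Arc XD u0 u0) : Prop :=
  normal_closure K1 Rel (f ;; ! g).

Section Modulo.
Context (Rel : relations).

Lemma nc_hom (f g : Arc XD u0 u0) : f ~~ g -> normal_closure K1 Rel f -> normal_closure K1 Rel g.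
Proof. intros e h; exact (nc_homotopic _ _ _ _ h (hom_homotopic f g e)). Qed.

#[local] Instance modulo_hom : subrelation hom (modulo Rel).
Proof.
intros f g e; apply (nc_hom (aone (fn_start g))); [|apply nc_one].
rewrite e; symmetry; apply ainv_r.
Qed.

#[local] Instance modulo_equiv : Equivalence (modulo Rel).
Proof.
split.
- intro f; apply modulo_hom; reflexivity.
- intros f g h; apply (nc_hom (! (f ;; ! g))); [|now apply (nc_inv K1 Rel (f ;; ! g))].
  rewrite ainv_cat, ainv_inv; reflexivity.
- intros f g h h1 h2; apply (nc_hom ((f ;; ! g) ;; (g ;; ! h))).
  + rewrite acat_assoc, ainv_catK; reflexivity.
  + exact (nc_mul K1 Rel _ _ h1 h2).
Qed.

Lemma nc_conj_arc (f g : Arc XD u0 u0) :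
  normal_closure K1 Rel g -> normal_closure K1 Rel (f ;; g ;; ! f).
Proof. exact (nc_conj K1 Rel f g (arc_is_loop f)). Qed.

#[local] Instance modulo_cat : Proper (modulo Rel ==> modulo Rel ==> modulo Rel) (@acat XD u0 u0 u0).
Proof.
intros f f' hf g g' hg.
(* Normality enters here: the quotient of the two products is a conjugate by [f] of the quotient of
   [g] and [g'], times the quotient of [f] and [f']. *)
apply (nc_hom ((f ;; (g ;; ! g') ;; ! f) ;; (f ;; ! f'))).
- rewrite ainv_cat, !acat_assoc, ainv_catK; reflexivity.
- exact (nc_mul K1 Rel _ _ (nc_conj_arc f _ hg) hf).
Qed.

#[local] Instance modulo_inv : Proper (modulo Rel ==> modulo Rel) (@ainv XD u0 u0).
Proof.
intros f g h; symmetry in h.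
apply (nc_hom (! f ;; (g ;; ! f) ;; ! ! f)); [|exact (nc_conj_arc (! f) _ h)].
rewrite ainv_inv, !acat_assoc, (ainv_l (fn_start f)), aone_r; rewrite ainv_inv; reflexivity.
Qed.

Lemma modulo_relations x1 x2 x3 x4 :
  let d := x4 ;; x3 ;; x2 ;; x1 in
  let e := x3 ;; x2 in
  (modulo Rel d (x1 ;; x4 ;; x3 ;; x2) /\
   modulo Rel (x1 ;; x4 ;; x3 ;; x2) (x3 ;; x2 ;; x1 ;; x4) /\
   modulo Rel (x4 ;; x3 ;; x2 ;; x1 ;; x3 ;; x2) (x2 ;; x4 ;; x3 ;; x2 ;; x1 ;; x3)) <->
  (modulo Rel (d ;; x1 ;; ! d) x1 /\ modulo Rel ((d ;; e) ;; x2 ;; ! (d ;; e)) x2 /\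
   modulo Rel ((d ;; e) ;; x3 ;; ! (d ;; e)) x3 /\ modulo Rel (d ;; x4 ;; ! d) x4).
Proof.
intros d e; rewrite !(conj_commutes (modulo Rel)); apply relations_iff; exact _.
Qed.

Lemma modulo_hom_iff f f' g g' : f ~~ f' -> g ~~ g' -> modulo Rel f g <-> modulo Rel f' g'.
Proof. intros -> ->; reflexivity. Qed.

End Modulo.

(** A normal closure is the least one containing its relators, so each inclusion has to be checked
    on relators only. *)
Lemma normal_closure_le (Rel Rel' : relations) :
  (forall g h, Rel g h -> normal_closure K1 Rel' (concat g (inverse h))) ->
  forall g, normal_closure K1 Rel g -> normal_closure K1 Rel' g.
Proof.
intros H g h; induction h.
- auto.
- apply nc_one.
- now apply nc_mul.
- now apply nc_inv.
- now apply nc_conj.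
- now apply nc_homotopic with g.
Qed.

(** For [y] off the fiber over [x = cis (2 PI s)], the rest of the twist, from time [s] to time [1],
    takes [y] off the fiber over [x = 1]. *)
Lemma untwist_XD s y : disk_D y -> ~ curve_S (cis (2 * PI * s)) y ->
  XD (rot (fun r => 2 * PI * (1 - s) * (outer r + inner r)) y).
Proof.
intros hd hn; split; [unfold disk_D; now rewrite Cmod_rot|].
set (z := rot _ y); intro hz; apply hn.
set (w := cis (2 * PI * s)).
assert (hw : (cis (2 * PI * (1 - s)) * w)%C = 1).
{ unfold w; rewrite cis_plus; replace (2 * PI * (1 - s) + 2 * PI * s) with (2 * PI) by ring.
  apply cis_2PI. }
assert (hm : Cmod y = Cmod z) by (unfold z; now rewrite Cmod_rot).
apply spin_mark; apply puncture_iff in hz as (i & hi & e); exists i; split; trivial.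
rewrite e; assert (hz : puncture z) by (apply puncture_iff; eauto).
destruct (puncture_Cmod z hz) as [h | h].
- rewrite spin_1 by trivial; unfold z, rot; rewrite hm, h, outer_2, inner_1 by lra.
  replace (2 * PI * (1 - s) * (1 + 1)) with (2 * PI * (1 - s) + 2 * PI * (1 - s)) by ring.
  rewrite <- cis_plus; fold w.
  transitivity (y * (cis (2 * PI * (1 - s)) * w) * (cis (2 * PI * (1 - s)) * w))%C; [ring|].
  rewrite hw; ring.
- rewrite spin_2 by trivial; unfold z, rot; rewrite hm, h, outer_2, inner_54 by lra.
  replace (2 * PI * (1 - s) * (1 + 0)) with (2 * PI * (1 - s)) by ring.
  fold w; rewrite <- Cmult_assoc, hw; ring.
Qed.

(** If [D] realizes the motion and [T] is the twist, then [T_1 T_s^-1 D_s] deforms [T_1] into [D_1]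
    through maps taking the fiber over [x = 1] to itself. *)
Lemma realization_twist m Dt (x : Arc XD u0 u0) :
  motion_of_curve 4 curve_S m -> realizes 4 m Dt ->
  homotopic K1 (twistO (twistI x)) (act (Dt 1) x).
Proof.
intros ((_ & hmd & _ & hm0 & _) & hS) (hdiff & hcont & hD0 & hbd & hDm).
assert (hu : forall s, unit_I s -> Dt s u0 = u0) by (intros; apply hbd; [assumption | apply Cmod_u0]).
(* [Dt s] is injective on the disk and carries the punctures onto the fiber at time [s], so it keeps
   the other points off that fiber. *)
assert (hX : forall s t, unit_I s -> unit_I t -> disk_D (Dt s (x t)) /\ ~ curve_S (cis (2 * PI * s)) (Dt s (x t))).
{ intros s t hs ht; destruct (fn_in x t ht) as [hd hp].
  destruct (hdiff s hs) as (_ & hdd & g & _ & _ & hg & _).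
  split; [now apply hdd|]; intro hc; apply hS in hc as (i & hi & e); trivial.
  apply hp, fiber_one_iff, hm0; exists i; split; trivial.
  rewrite <- hDm in e by trivial.
  rewrite <- (hg (m i 0)), e; [now apply hg | apply hmd; trivial]. }
exists (fun s t => rot (fun r => 2 * PI * (1 - clamp s) * (outer r + inner r)) (Dt (clamp s) (x (clamp t)))).
split; [|split; [|split]].
- apply continuous_on_forall; intros q _.
  assert (c : contC (fun q : prod_UniformSpace R_UniformSpace R_UniformSpace => Dt (clamp (fst q)) (x (clamp (snd q))))).
  { apply (contC_on_comp (fun q : R * C => unit_I (fst q) /\ disk_D (snd q))
      (fun q : R * C => Dt (fst q) (snd q)) (fun q : R * R => (clamp (fst q), x (clamp (snd q))))).
    - exact hcont.
    - intro z.
      apply (continuous_comp_2 (fun q : R * R => clamp (fst q)) (fun q : R * R => x (clamp (snd q))) (fun (a : R) (b : C) => (a, b))).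
      + apply (contR_clamp (fun q => fst q) contR_fst2).
      + apply (contC_contR x (fun q => clamp (snd q)) (fn_cont x) (contR_clamp (fun q => snd q) contR_snd2)).
      + eapply continuous_ext; [|apply continuous_id]; now intros [? ?].
    - intros z; split; [apply clamp_unit | apply (proj1 (fn_in x _ (clamp_unit _)))]. }
  generalize contR_outer contR_inner; intros co ci.
  revert q; fold (@contC (prod_UniformSpace R_UniformSpace R_UniformSpace)
    (fun q => rot (fun r => 2 * PI * (1 - clamp (fst q)) * (outer r + inner r)) (Dt (clamp (fst q)) (x (clamp (snd q)))))).
  unfold rot; apply contC_mult; [exact c|].
  apply contC_cis, contR_mult; [cont|].
  apply contR_plus; apply contR_comp; trivial; now apply contR_Cmod.
- intros s t hs ht; rewrite !clamp_id by trivial; apply XD_iff.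
  now apply untwist_XD; apply hX.
- intros s hs; rewrite !clamp_id, fn_0, fn_1, hu by auto.
  rewrite rot_fix; [now split|].
  rewrite Cmod_u0, outer_4, inner_54 by lra; rewrite Rplus_0_l, Rmult_0_r; apply cis_0.
- intros t ht; rewrite !clamp_id by auto; split.
  + rewrite hD0 by apply (proj1 (fn_in x t ht)).
    change (rot (fun r => 2 * PI * (1 - 0) * (outer r + inner r)) (x t) = rotO (rotI (x t))).
    unfold rotO, rotI; rewrite rot_rot; unfold rot; do 2 f_equal; ring.
  + apply rot_fix; rewrite Rminus_diag, Rmult_0_r, Rmult_0_l; apply cis_0.
Qed.

(** Two homotopies are joined at [act (Dt 1) x]: one from [same_braid], the other from the twist.
    The image path is controlled only on the unit interval, hence the arc [y]. *)
Lemma monodromy_action beta (x : Arc XD u0 u0) : local_braid_monodromy 4 curve_S beta ->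
  exists y : Arc XD u0 u0, (forall t, unit_I t -> y t = act beta x t) /\ y ~~ twistO (twistI x).
Proof.
intros (m & hm & _ & Dt & hr & hb).
destruct (homotopic_arcs _ _ (hb x (arc_is_loop x))) as (f & k & e & hf & hk).
destruct (homotopic_arcs _ _ (realization_twist m Dt x hm hr)) as (f' & k' & e' & hf' & hk').
exists f; split; trivial.
rewrite e; transitivity k'; [apply hom_ext; intros; now rewrite hk, hk'|].
rewrite <- e'; now apply hom_ext.
Qed.

Lemma ordered_points_mark p i : ordered_points 4 K1 p -> idx 4 i -> p i = mark i.
Proof.
unfold idx; intros [hlt hp] hi.
assert (v : forall j, idx 4 j -> p j = -2 \/ p j = -1 \/ p j = 1 \/ p j = 2).
{ intros j hj; assert (h : puncture (RtoC (p j))) by (apply fiber_one_iff, hp; eauto).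
  exact (proj2 h). }
assert (l1 : p 1%nat < p 2%nat) by (apply hlt; unfold idx; lia).
assert (l2 : p 2%nat < p 3%nat) by (apply hlt; unfold idx; lia).
assert (l3 : p 3%nat < p 4%nat) by (apply hlt; unfold idx; lia).
assert (v1 : idx 4 1) by (unfold idx; lia); assert (v2 : idx 4 2) by (unfold idx; lia).
assert (v3 : idx 4 3) by (unfold idx; lia); assert (v4 : idx 4 4) by (unfold idx; lia).
apply v in v1, v2, v3, v4.
assert (a1 : p 1%nat = -2 /\ p 2%nat = -1 /\ p 3%nat = 1 /\ p 4%nat = 2).
{ destruct v1 as [e1 | [e1 | [e1 | e1]]], v2 as [e2 | [e2 | [e2 | e2]]]; try lra;
  destruct v3 as [e3 | [e3 | [e3 | e3]]]; try lra;
  destruct v4 as [e4 | [e4 | [e4 | e4]]]; lra. }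
assert (h : (i = 1 \/ i = 2 \/ i = 3 \/ i = 4)%nat) by lia.
destruct h as [-> | [-> | [-> | ->]]]; simpl; tauto.
Qed.

(** [d] and [e] are the loops around all four punctures and around the inner two. *)
Lemma twist_generators (x1 x2 x3 x4 : Arc XD u0 u0) :
  x1 ~~ cross 1 ;; ! cross 0 -> x2 ~~ cross 2 ;; ! cross 1 ->
  x3 ~~ cross 3 ;; ! cross 2 -> x4 ~~ cross 4 ;; ! cross 3 ->
  let d := x4 ;; x3 ;; x2 ;; x1 in
  let e := x3 ;; x2 in
  twistO (twistI x1) ~~ d ;; x1 ;; ! d /\
  twistO (twistI x2) ~~ (d ;; e) ;; x2 ;; ! (d ;; e) /\
  twistO (twistI x3) ~~ (d ;; e) ;; x3 ;; ! (d ;; e) /\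
  twistO (twistI x4) ~~ d ;; x4 ;; ! d.
Proof.
intros h1 h2 h3 h4 d e.
(* The word telescopes, each generator being a quotient of consecutive crossing arcs. *)
assert (hd : d ~~ cross 4 ;; ! cross 0).
{ unfold d; rewrite h1, h2, h3, h4, !acat_assoc, !ainv_catK; reflexivity. }
assert (he : e ~~ cross 3 ;; ! cross 1).
{ unfold e; rewrite h2, h3, !acat_assoc, !ainv_catK; reflexivity. }
repeat split; rewrite twistO_conj, <- hd.
- rewrite (twistI_fix 0 x1); auto; reflexivity.
- rewrite (twistI_conj 1 x2), <- he; auto.
  rewrite !ainv_cat, !acat_assoc; reflexivity.
- rewrite (twistI_conj 2 x3), <- he; auto.
  rewrite !ainv_cat, !acat_assoc; reflexivity.
- rewrite (twistI_fix 3 x4); auto; reflexivity.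
Qed.

Theorem corollary5p9 :
  (exists beta : C -> C, local_braid_monodromy 4 curve_S beta) /\
  (forall (beta : C -> C) (p : nat -> R) (eps : R),
     local_braid_monodromy 4 curve_S beta ->
     ordered_points 4 (fiber_one curve_S) p ->
     0 < eps < 1 ->
     let x := standard_g_base eps p in
     same_normal_closure (fiber_one curve_S)
       (relations_of_list
          [ (word x [4; 3; 2; 1]%nat, word x [1; 4; 3; 2]%nat);
            (word x [1; 4; 3; 2]%nat, word x [3; 2; 1; 4]%nat);
            (word x [4; 3; 2; 1; 3; 2]%nat, word x [2; 4; 3; 2; 1; 3]%nat) ])
       (induced_relations 4 beta x)).
Proof.
split; [exact monodromy_exists|].
intros beta p eps hb hp he x.
assert (hx : forall j, (j <= 3)%nat -> x (S j) = g_loop eps (mark (S j))).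
{ intros j hj; unfold x, standard_g_base; rewrite (ordered_points_mark p (S j)); trivial.
  unfold idx; lia. }
destruct (g_loop_arc 0 eps) as (x1 & f1 & h1); [lia | trivial |].
destruct (g_loop_arc 1 eps) as (x2 & f2 & h2); [lia | trivial |].
destruct (g_loop_arc 2 eps) as (x3 & f3 & h3); [lia | trivial |].
destruct (g_loop_arc 3 eps) as (x4 & f4 & h4); [lia | trivial |].
rewrite <- hx in f1, f2, f3, f4 by lia.
clearbody x.
destruct (twist_generators x1 x2 x3 x4 h1 h2 h3 h4) as (t1 & t2 & t3 & t4).
assert (o := fn_start x1).
unfold word; simpl fold_right; rewrite <- f1, <- f2, <- f3, <- f4.
set (Rel := relations_of_list _).
(* [Rel'] is arbitrary so that the same equivalence serves both inclusions at the end. *)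
assert (hR : forall Rel' : relations,
  (forall g h, Rel g h -> normal_closure K1 Rel' (concat g (inverse h))) <->
  (modulo Rel' (x4 ;; x3 ;; x2 ;; x1) (x1 ;; x4 ;; x3 ;; x2) /\
   modulo Rel' (x1 ;; x4 ;; x3 ;; x2) (x3 ;; x2 ;; x1 ;; x4) /\
   modulo Rel' (x4 ;; x3 ;; x2 ;; x1 ;; x3 ;; x2) (x2 ;; x4 ;; x3 ;; x2 ;; x1 ;; x3))).
{ intro Rel'.
  (* Every [word] ends with the constant loop, which is removed here; the six-letter words are
     reduced to their last four letters. *)
  assert (w4 : forall f g h k : Arc XD u0 u0, f ;; g ;; h ;; k ;; aone o ~~ f ;; g ;; h ;; k)
    by (intros; rewrite aone_r; reflexivity).
  rewrite <- (modulo_hom_iff Rel' _ _ _ _ (w4 x4 x3 x2 x1) (w4 x1 x4 x3 x2)),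
    <- (modulo_hom_iff Rel' _ _ _ _ (w4 x1 x4 x3 x2) (w4 x3 x2 x1 x4)),
    <- (modulo_hom_iff Rel' _ _ _ _ (hom_acat _ _ _ _ (hom_refl x4) (hom_acat _ _ _ _ (hom_refl x3) (w4 x2 x1 x3 x2)))
          (hom_acat _ _ _ _ (hom_refl x2) (hom_acat _ _ _ _ (hom_refl x4) (w4 x3 x2 x1 x3)))).
  split.
  - intro h; split; [|split]; apply h; [left | right; left | right; right; left]; reflexivity.
  - intros (r1 & r2 & r3) g h [e | [e | [e | []]]]; inversion e; [exact r1 | exact r2 | exact r3]. }
assert (hS : forall Rel' : relations,
  (forall g h, induced_relations 4 beta x g h -> normal_closure K1 Rel' (concat g (inverse h))) <->
  (modulo Rel' (twistO (twistI x1)) x1 /\ modulo Rel' (twistO (twistI x2)) x2 /\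
   modulo Rel' (twistO (twistI x3)) x3 /\ modulo Rel' (twistO (twistI x4)) x4)).
{ intro Rel'.
  assert (h : forall y : Arc XD u0 u0,
    normal_closure K1 Rel' (concat (act beta y) (inverse y)) <-> modulo Rel' (twistO (twistI y)) y).
  { intro y; destruct (monodromy_action beta y hb) as (z & hz & e).
    rewrite <- (modulo_hom_iff Rel' z _ y y e (hom_refl y)); unfold modulo.
    assert (c : forall t, unit_I t -> concat (act beta y) (inverse y) t = (z ;; ! y) t).
    { intros t [? ?]; simpl; unfold concat; destruct (Rle_dec _ _); trivial.
      symmetry; apply hz; split; lra. }
    split; intro n; refine (nc_homotopic _ _ _ _ n _); apply (homotopic_of_eq (z ;; ! y)); auto. }
  rewrite <- !h, f1, f2, f3, f4; split.
  - intro g; repeat split; apply g; eexists; (split; [|split; reflexivity]); unfold idx; lia.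
  - intros (r1 & r2 & r3 & r4) g k (j & hj & -> & ->); unfold idx in hj.
    assert (q : (j = 1 \/ j = 2 \/ j = 3 \/ j = 4)%nat) by lia.
    destruct q as [-> | [-> | [-> | ->]]]; assumption. }
assert (key : forall Rel' : relations,
  (forall g h, Rel g h -> normal_closure K1 Rel' (concat g (inverse h))) <->
  (forall g h, induced_relations 4 beta x g h -> normal_closure K1 Rel' (concat g (inverse h)))).
{ intro Rel'; rewrite hR, hS, modulo_relations.
  rewrite <- (modulo_hom_iff Rel' _ _ _ _ t1 (hom_refl x1)), <- (modulo_hom_iff Rel' _ _ _ _ t2 (hom_refl x2)),
    <- (modulo_hom_iff Rel' _ _ _ _ t3 (hom_refl x3)), <- (modulo_hom_iff Rel' _ _ _ _ t4 (hom_refl x4)).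
  reflexivity. }
(* [key] is used with [Rel'] equal to each of the two sets in turn, whose own relators lie in its
   normal closure by [nc_gen]. *)
intro g; split; apply normal_closure_le.
- apply key; intros; now apply nc_gen.
- apply key; intros; now apply nc_gen.
Qed.
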